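(* Let $A$ be a finite-dimensional selfinjective algebra over a field such that all simple $A$-modules are nonprojective. The following hold. (i) If $\mathcal{D}$ is a distinguished abelian subcategory of $\underline{\mathrm{mod}}(A)$ containing all simple $A$-modules, then the simple $A$-modules are exactly the simple objects in $\mathcal{D}$ (up to isomorphism in $\underline{\mathrm{mod}}(A)$). In particular, in that case we have $\ell(A)=\ell(\mathcal{D})$. (ii) The stable module category $\underline{\mathrm{mod}}(A)$ has a maximal distinguished abelian subcategory $\mathcal{D}$ satisfying $\ell(\mathcal{D})=\ell(A)$.
   Context: Algebras are nonzero, unital and associative; modules are unital left modules. For a finite-dimensional $k$-algebra $A$ over a field $k$, $\mathrm{mod}(A)$ is the category of finitely generated $A$-modules, and $\underline{\mathrm{mod}}(A)$ is the stable module category: it has the same objects as $\mathrm{mod}(A)$, and morphism spaces $\underline{\mathrm{Hom}}_A(U,V)=\mathrm{Hom}_A(U,V)/\mathrm{Hom}_A^{\mathrm{pr}}(U,V)$, where $\mathrm{Hom}_A^{\mathrm{pr}}(U,V)$ is the space of $A$-homomorphisms which factor through a projective $A$-module. $A$ is selfinjective if $A$ is injective as a left $A$-module; then $\underline{\mathrm{mod}}(A)$ is a triangulated category with shift functor $\Sigma$ induced by sending a module to the cokernel of an injective envelope, and with exact triangles induced by short exact sequences in $\mathrm{mod}(A)$. A distinguished abelian subcategory of a triangulated category $\mathcal{C}$ with shift functor $\Sigma$ is a full additive subcategory $\mathcal{D}$ of $\mathcal{C}$ which is abelian, such that for any short exact sequence $0\to X\xrightarrow{f} Y\xrightarrow{g}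 Z\to 0$ in $\mathcal{D}$ there exists a morphism $h:Z\to\Sigma(X)$ in $\mathcal{C}$ such that the triangle $X\xrightarrow{f} Y\xrightarrow{g} Z\xrightarrow{h}\Sigma(X)$ is exact in $\mathcal{C}$. Maximal means maximal among distinguished abelian subcategories with respect to inclusion of subcategories. For an abelian category $\mathcal{D}$, $\ell(\mathcal{D})$ denotes the number of isomorphism classes of simple objects of $\mathcal{D}$, with $\ell(\mathcal{D})=\infty$ if there are infinitely many; $\ell(A)=\ell(\mathrm{mod}(A))$ is the number of isomorphism classes of simple $A$-modules. *)

(* Defs.v *)
From HB Require Import structures.
From mathcomp Require Import all_boot all_algebra.
From mathcomp Require Import generic_quotient ring_quotient.
From mathcomp Require Import boolp classical_sets.

Set Implicit Arguments.
Unset Strict Implicit.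
Unset Printing Implicit Defensive.

Import GRing.Theory.
Local Open Scope ring_scope.
Local Open Scope quotient_scope.

Record preadditive := Preadditive {
  ob :> Type;
  hom : ob -> ob -> zmodType;
  idm : forall X, hom X X;
  ccomp : forall X Y Z, hom Y Z -> hom X Y -> hom X Z;
  ccompA : forall W X Y Z (h : hom Y Z) (g : hom X Y) (f : hom W X),
    ccomp h (ccomp g f) = ccomp (ccomp h g) f;
  ccomp1m : forall X Y (f : hom X Y), ccomp (idm Y) f = f;
  ccompm1 : forall X Y (f : hom X Y), ccomp f (idm X) = f;
  ccompDl : forall X Y Z (g g' : hom Y Z) (f : hom X Y),
    ccomp (g + g') f = ccomp g f + ccomp g' f;
  ccompDr : forall X Y Z (g : hom Y Z) (f f' : hom X Y),
    ccomp g (f + f') = ccomp g f + ccomp g f' }.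

Arguments idm {p} X.

Local Notation "g \oc f" := (ccomp g f) (at level 40, left associativity).

Section Preadditive.
Variable C : preadditive.

Definition is_iso (X Y : C) (f : hom X Y) : Prop :=
  exists g : hom Y X, g \oc f = idm X /\ f \oc g = idm Y.

Definition isomorphic (X Y : C) : Prop := exists f : hom X Y, is_iso f.

Definition is_mono (X Y : C) (f : hom X Y) : Prop :=
  forall (T : C) (u v : hom T X), f \oc u = f \oc v -> u = v.

Definition is_epi (X Y : C) (f : hom X Y) : Prop :=
  forall (T : C) (u v : hom Y T), u \oc f = v \oc f -> u = v.

Definition is_zero_object (Z : C) : Prop :=
  forall X : C, (forall f : hom X Z, f = 0) /\ (forall f : hom Z X, f = 0).

Definition is_biproduct (X Y P : C) (i1 : hom X P) (i2 : hom Y P)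
    (p1 : hom P X) (p2 : hom P Y) : Prop :=
  [/\ p1 \oc i1 = idm X, p2 \oc i2 = idm Y, p1 \oc i2 = 0, p2 \oc i1 = 0
    & i1 \oc p1 + i2 \oc p2 = idm P].

Definition is_additive : Prop :=
  (exists Z : C, is_zero_object Z) /\
  (forall X Y : C, exists (P : C) (i1 : hom X P) (i2 : hom Y P)
     (p1 : hom P X) (p2 : hom P Y), is_biproduct i1 i2 p1 p2).

Definition is_kernel (K X Y : C) (k : hom K X) (f : hom X Y) : Prop :=
  f \oc k = 0 /\
  forall (T : C) (t : hom T X), f \oc t = 0 -> exists! u : hom T K, k \oc u = t.

Definition is_cokernel (X Y Q : C) (q : hom Y Q) (f : hom X Y) : Prop :=
  q \oc f = 0 /\
  forall (T : C) (t : hom Y T), t \oc f = 0 -> exists! u : hom Q T, u \oc q = t.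

Definition is_abelian : Prop :=
  [/\ is_additive,
      forall (X Y : C) (f : hom X Y), exists (K : C) (k : hom K X), is_kernel k f,
      forall (X Y : C) (f : hom X Y), exists (Q : C) (q : hom Y Q), is_cokernel q f,
      forall (X Y : C) (f : hom X Y), is_mono f ->
        exists (Z : C) (g : hom Y Z), is_kernel f g
    & forall (X Y : C) (f : hom X Y), is_epi f ->
        exists (W : C) (g : hom W X), is_cokernel f g].

Definition short_exact (X Y Z : C) (f : hom X Y) (g : hom Y Z) : Prop :=
  is_kernel f g /\ is_cokernel g f.

Definition simple_object (X : C) : Prop :=
  ~ is_zero_object X /\
  forall (Y : C) (m : hom Y X), is_mono m -> is_zero_object Y \/ is_iso m.

Definition simple_count (n : nat) : Prop :=
  exists S : 'I_n -> C,
    [/\ forall i, simple_object (S i),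
        forall i j, isomorphic (S i) (S j) -> i = j
      & forall X : C, simple_object X -> exists i, isomorphic X (S i)].

(** [Some n] stands for the natural number [n], and [None] for infinity. *)
Definition ell : option nat :=
  xget None [set o | exists2 n, o = Some n & simple_count n]%classic.

End Preadditive.

Definition full_subcategory (C : preadditive) (D : C -> Prop) : preadditive :=
  {| ob := {X : C | D X};
     hom := fun X Y => hom (proj1_sig X) (proj1_sig Y);
     idm := fun X => idm (proj1_sig X);
     ccomp := fun X Y Z => @ccomp C (proj1_sig X) (proj1_sig Y) (proj1_sig Z);
     ccompA := fun W X Y Z =>
       @ccompA C (proj1_sig W) (proj1_sig X) (proj1_sig Y) (proj1_sig Z);
     ccomp1m := fun X Y => @ccomp1m C (proj1_sig X) (proj1_sig Y);
     ccompm1 := fun X Y => @ccompm1 C (proj1_sig X) (proj1_sig Y);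
     ccompDl := fun X Y Z =>
       @ccompDl C (proj1_sig X) (proj1_sig Y) (proj1_sig Z);
     ccompDr := fun X Y Z =>
       @ccompDr C (proj1_sig X) (proj1_sig Y) (proj1_sig Z) |}.

Section Modules.
Variable A : nzRingType.

Definition finitely_generated (V : lmodType A) : Prop :=
  exists (n : nat) (g : 'I_n -> V),
    forall x : V, exists c : 'I_n -> A, x = \sum_(i < n) c i *: g i.

Definition projective_module (P : lmodType A) : Prop :=
  forall (M N : lmodType A) (g : {linear M -> N}) (f : {linear P -> N}),
    (forall y : N, exists x : M, g x = y) ->
    exists h : {linear P -> M}, forall x, g (h x) = f x.

Definition injective_module (I : lmodType A) : Prop :=
  forall (M N : lmodType A) (i : {linear M -> N}) (f : {linear M -> I}),
    injective i -> exists h : {linear N -> I}, forall x, h (i x) = f x.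

Definition simple_module (V : lmodType A) : Prop :=
  (exists x : V, x != 0) /\
  forall N : {pred V}, GRing.submod_closed N ->
    (forall x, x \in N -> x = 0) \/ (forall x, x \in N).

(** The image of [i] meets every nonzero submodule nontrivially. *)
Definition essential (U V : lmodType A) (i : {linear U -> V}) : Prop :=
  forall N : {pred V}, GRing.submod_closed N ->
    (forall x, i x \in N -> i x = 0) -> forall y, y \in N -> y = 0.

Definition module_ses (U V W : lmodType A)
    (i : {linear U -> V}) (p : {linear V -> W}) : Prop :=
  [/\ injective i,
      forall y, p y = 0 <-> exists x, i x = y
    & forall z, exists y, p y = z].

Record fgmodule := FGModule {
  fgmod_sort :> lmodType A;
  fgmod_fg : finitely_generated fgmod_sort }.

Definition mhom (U V : fgmodule) : Type := {linear U -> V}.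

End Modules.

Definition selfinjective (A : nzRingType) : Prop :=
  injective_module (A^o : lmodType A).

Lemma linear_ext (A : nzRingType) (U V : lmodType A) (f g : {linear U -> V}) :
  f =1 g -> f = g.
Proof.
case: f => f [[f1] [f2]]; case: g => g [[g1] [g2]] /= /funext e.
move: f1 f2 g1 g2; rewrite e => f1 f2 g1 g2.
by rewrite (Prop_irrelevance f1 g1) (Prop_irrelevance f2 g2).
Qed.

Section ModuleHom.
Variables (A : nzRingType) (U V : fgmodule A).

HB.instance Definition _ := gen_eqMixin (mhom U V).
HB.instance Definition _ := gen_choiceMixin (mhom U V).

Definition mhom_zero : mhom U V := \0 : {linear U -> V}.
Definition mhom_opp (f : mhom U V) : mhom U V := (\- f)%R : {linear U -> V}.
Definition mhom_add (f g : mhom U V) : mhom U V := (f \+ g)%R : {linear U -> V}.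

Lemma mhom_addA : associative mhom_add.
Proof. by move=> f g h; apply: linear_ext => x /=; rewrite addrA. Qed.
Lemma mhom_addC : commutative mhom_add.
Proof. by move=> f g; apply: linear_ext => x /=; rewrite addrC. Qed.
Lemma mhom_add0 : left_id mhom_zero mhom_add.
Proof. by move=> f; apply: linear_ext => x /=; rewrite add0r. Qed.
Lemma mhom_addN : left_inverse mhom_zero mhom_opp mhom_add.
Proof. by move=> f; apply: linear_ext => x /=; rewrite addNr. Qed.

HB.instance Definition _ :=
  GRing.isZmodule.Build (mhom U V) mhom_addA mhom_addC mhom_add0 mhom_addN.

End ModuleHom.

Section ModuleCategory.
Variable A : nzRingType.

Definition mhom_id (U : fgmodule A) : mhom U U := idfun : {linear U -> U}.
Definition mhom_comp (U V W : fgmodule A) (g : mhom V W) (f : mhom U V) :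
  mhom U W := (g \o f : {linear U -> W}).

Lemma mhom_compA (T U V W : fgmodule A)
    (h : mhom V W) (g : mhom U V) (f : mhom T U) :
  mhom_comp h (mhom_comp g f) = mhom_comp (mhom_comp h g) f.
Proof. exact: linear_ext. Qed.
Lemma mhom_comp1m (U V : fgmodule A) (f : mhom U V) :
  mhom_comp (mhom_id V) f = f.
Proof. exact: linear_ext. Qed.
Lemma mhom_compm1 (U V : fgmodule A) (f : mhom U V) :
  mhom_comp f (mhom_id U) = f.
Proof. exact: linear_ext. Qed.
Lemma mhom_compDl (U V W : fgmodule A) (g g' : mhom V W) (f : mhom U V) :
  mhom_comp (g + g') f = mhom_comp g f + mhom_comp g' f.
Proof. exact: linear_ext. Qed.
Lemma mhom_compDr (U V W : fgmodule A) (g : mhom V W) (f f' : mhom U V) :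
  mhom_comp g (f + f') = mhom_comp g f + mhom_comp g f'.
Proof. by apply: linear_ext => x /=; rewrite linearD. Qed.

Definition modcat : preadditive :=
  {| ob := fgmodule A;
     hom := fun U V => mhom U V : zmodType;
     idm := mhom_id;
     ccomp := mhom_comp;
     ccompA := mhom_compA;
     ccomp1m := mhom_comp1m;
     ccompm1 := mhom_compm1;
     ccompDl := mhom_compDl;
     ccompDr := mhom_compDr |}.

End ModuleCategory.

Section StableHom.
Variables (A : nzRingType) (U V : fgmodule A).

Definition factors_through_projective (f : {linear U -> V}) : Prop :=
  exists (P : lmodType A) (u : {linear U -> P}) (v : {linear P -> V}),
    projective_module P /\ forall x, f x = v (u x).

Definition prhom : {pred mhom U V} :=
  fun f => `[< factors_through_projective f >].

Lemma projective_module0 : projective_module ('rV[A]_0 : lmodType A).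
Proof.
move=> M N g f _; exists (\0 : {linear 'rV[A]_0 -> M}) => x.
by rewrite (thinmx0 x) !linear0.
Qed.

Definition mk_linear (M N : lmodType A) (f : M -> N) (lf : linear f) :
    {linear M -> N} :=
  HB.pack f (GRing.isLinear.Build A M N *:%R f lf).

Lemma projective_module_prod (P Q : lmodType A) :
  projective_module P -> projective_module Q ->
  projective_module ((P * Q)%type : lmodType A).
Proof.
move=> hP hQ M N g f sg.
have l1 : linear (fun p : P => (p, 0) : (P * Q)%type).
  by move=> a x y; congr pair; rewrite /= scaler0 addr0.
have l2 : linear (fun q : Q => (0, q) : (P * Q)%type).
  by move=> a x y; congr pair; rewrite /= scaler0 addr0.
have [h1 e1] := hP M N g (f \o mk_linear l1 : {linear P -> N}) sg.
have [h2 e2] := hQ M N g (f \o mk_linear l2 : {linear Q -> N}) sg.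
have l : linear (fun z : (P * Q)%type => h1 z.1 + h2 z.2).
  by move=> a x y /=; rewrite !linearP scalerDr addrACA.
exists (mk_linear l) => -[x y] /=.
rewrite linearD e1 e2 /= -linearD; congr (f _).
by congr pair; rewrite ?addr0 ?add0r.
Qed.

Lemma prhom_zmod_closed : zmod_closed prhom.
Proof.
split=> [|f f'].
  apply/asboolP; exists ('rV[A]_0 : lmodType A), \0, \0.
  by split; first exact: projective_module0.
move=> /asboolP [P [u [v [hP e]]]] /asboolP [P' [u' [v' [hP' e']]]].
apply/asboolP.
have lu : linear (fun x => (u x, u' x) : (P * P')%type).
  by move=> a x y; congr pair; rewrite linearP.
have lv : linear (fun z : (P * P')%type => v z.1 - v' z.2).
  move=> a x y /=; rewrite !linearP scalerDr.
  by rewrite addrACA.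
exists ((P * P')%type : lmodType A), (mk_linear lu), (mk_linear lv).
by split=> [|x]; [exact: projective_module_prod | rewrite /= -e -e'].
Qed.

HB.instance Definition _ :=
  GRing.isZmodClosed.Build (mhom U V) prhom prhom_zmod_closed.

Definition sthom : zmodType := {ideal_quot (prhom : zmodClosed (mhom U V))}.

Definition stable (f : mhom U V) : sthom := \pi_{ideal_quot (prhom : zmodClosed (mhom U V))} f.

Lemma stable_eq (f g : mhom U V) :
  stable f = stable g <-> factors_through_projective (f - g : mhom U V).
Proof.
split=> [/eqP|/asboolP h]; last apply/eqP.
  by rewrite -Quotient.idealrBE => /asboolP.
by rewrite -Quotient.idealrBE.
Qed.

Lemma stableD (f g : mhom U V) : stable (f + g) = stable f + stable g.
Proof. by rewrite /stable !piE. Qed.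

Lemma stable_repr (f : sthom) : stable (repr f) = f.
Proof. exact: reprK. Qed.

End StableHom.

Section StableCategory.
Variable A : nzRingType.

Definition st_id (U : fgmodule A) : sthom U U := stable (mhom_id U).
Definition st_comp (U V W : fgmodule A) (g : sthom V W) (f : sthom U V) :
  sthom U W := stable (mhom_comp (repr g) (repr f)).

Lemma st_compE (U V W : fgmodule A) (g : mhom V W) (f : mhom U V) :
  st_comp (stable g) (stable f) = stable (mhom_comp g f).
Proof.
set g' := repr (stable g); set f' := repr (stable f).
have /stable_eq [P [u [v [hP e]]]] : stable g' = stable g by rewrite stable_repr.
have /stable_eq [Q [s [t [hQ e']]]] : stable f' = stable f by rewrite stable_repr.
transitivity (stable (mhom_comp g' f)); apply/stable_eq.
  exists Q, s, (g' \o t : {linear Q -> W}); split=> // x /=.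
  by rewrite -e' /= linearB.
exists P, (u \o f : {linear U -> P}), v; split=> // x /=.
by rewrite -e.
Qed.

Lemma st_compA (T U V W : fgmodule A)
    (h : sthom V W) (g : sthom U V) (f : sthom T U) :
  st_comp h (st_comp g f) = st_comp (st_comp h g) f.
Proof.
rewrite -(stable_repr h) -(stable_repr g) -(stable_repr f).
by rewrite !st_compE mhom_compA.
Qed.
Lemma st_comp1m (U V : fgmodule A) (f : sthom U V) : st_comp (st_id V) f = f.
Proof. by rewrite -(stable_repr f) st_compE mhom_comp1m. Qed.
Lemma st_compm1 (U V : fgmodule A) (f : sthom U V) : st_comp f (st_id U) = f.
Proof. by rewrite -(stable_repr f) st_compE mhom_compm1. Qed.
Lemma st_compDl (U V W : fgmodule A) (g g' : sthom V W) (f : sthom U V) :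
  st_comp (g + g') f = st_comp g f + st_comp g' f.
Proof.
rewrite -(stable_repr g) -(stable_repr g') -(stable_repr f).
by rewrite -stableD !st_compE mhom_compDl stableD.
Qed.
Lemma st_compDr (U V W : fgmodule A) (g : sthom V W) (f f' : sthom U V) :
  st_comp g (f + f') = st_comp g f + st_comp g f'.
Proof.
rewrite -(stable_repr g) -(stable_repr f) -(stable_repr f').
by rewrite -stableD !st_compE mhom_compDr stableD.
Qed.

Definition stmodcat : preadditive :=
  {| ob := fgmodule A;
     hom := @sthom A;
     idm := st_id;
     ccomp := st_comp;
     ccompA := st_compA;
     ccomp1m := st_comp1m;
     ccompm1 := st_compm1;
     ccompDl := st_compDl;
     ccompDr := st_compDr |}.

End StableCategory.

Section Triangles.
Variable A : nzRingType.

Record cosyzygy (U : fgmodule A) := Cosyzygy {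
  cosyz_env : fgmodule A;
  cosyz_cok : fgmodule A;
  cosyz_inj : mhom U cosyz_env;
  cosyz_proj : mhom cosyz_env cosyz_cok }.

Definition is_cosyzygy (U : fgmodule A) (c : cosyzygy U) : Prop :=
  [/\ injective_module (cosyz_env c), essential (cosyz_inj c)
    & module_ses (cosyz_inj c) (cosyz_proj c)].

(** A chosen injective envelope of [U] with its cokernel; the fallback value
    is irrelevant, since finitely generated modules over a finite-dimensional
    algebra have finitely generated injective envelopes. *)
Definition chosen_cosyzygy (U : fgmodule A) : cosyzygy U :=
  if pselect (exists c : cosyzygy U, is_cosyzygy c) is left e
  then proj1_sig (cid e) else Cosyzygy (mhom_id U) (mhom_id U).

Definition envelope (U : fgmodule A) : fgmodule A := cosyz_env (chosen_cosyzygy U).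
Definition Sigma (U : fgmodule A) : fgmodule A := cosyz_cok (chosen_cosyzygy U).
Definition env_inj (U : fgmodule A) : mhom U (envelope U) :=
  cosyz_inj (chosen_cosyzygy U).
Definition env_proj (U : fgmodule A) : mhom (envelope U) (Sigma U) :=
  cosyz_proj (chosen_cosyzygy U).

Local Notation stHom := (@hom (stmodcat A)).

(** The graph of the action of the shift functor on morphisms: [s] is induced
    by an extension of a representative of [f] to the injective envelopes. *)
Definition Sigma_graph (U V : fgmodule A)
    (f : stHom U V) (s : stHom (Sigma U) (Sigma V)) : Prop :=
  exists (f0 : mhom U V) (e : mhom (envelope U) (envelope V))
         (s0 : mhom (Sigma U) (Sigma V)),
    [/\ f = stable f0, s = stable s0,
        forall x, e (env_inj U x) = env_inj V (f0 x)
      & forall x, s0 (env_proj U x) = env_proj V (e x)].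

(** The triangle of a short exact sequence: [h] is induced by an extension [v]
    of the inclusion of [U] in its injective envelope.  The opposite
    sign convention replaces [h] by [- h] and does not change the notion of
    distinguished subcategory, where only the existence of [h] matters. *)
Definition standard_triangle (U V W : fgmodule A)
    (f : stHom U V) (g : stHom V W) (h : stHom W (Sigma U)) : Prop :=
  exists (i : mhom U V) (p : mhom V W) (v : mhom V (envelope U))
         (d : mhom W (Sigma U)),
    [/\ f = stable i, g = stable p & h = stable d] /\
    [/\ module_ses i p,
        forall x, v (i x) = env_inj U x
      & forall y, d (p y) = env_proj U (v y)].

Definition exact_triangle (X Y Z : fgmodule A)
    (f : stHom X Y) (g : stHom Y Z) (h : stHom Z (Sigma X)) : Prop :=
  exists (U V W : fgmodule A)
         (f' : stHom U V) (g' : stHom V W) (h' : stHom W (Sigma U))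
         (a : stHom X U) (b : stHom Y V) (c : stHom Z W)
         (s : stHom (Sigma X) (Sigma U)),
    [/\ standard_triangle f' g' h', is_iso a, is_iso b, is_iso c
      & Sigma_graph a s] /\
    [/\ b \oc f = f' \oc a, c \oc g = g' \oc b & s \oc h = h' \oc c].

Definition distinguished_abelian (D : stmodcat A -> Prop) : Prop :=
  is_abelian (full_subcategory D) /\
  forall (X Y Z : full_subcategory D) (f : hom X Y) (g : hom Y Z),
    short_exact f g ->
    exists h : stHom (proj1_sig Z) (Sigma (proj1_sig X)),
      @exact_triangle (proj1_sig X) (proj1_sig Y) (proj1_sig Z) f g h.

Definition maximal_distinguished_abelian (D : stmodcat A -> Prop) : Prop :=
  distinguished_abelian D /\
  forall D' : stmodcat A -> Prop, distinguished_abelian D' ->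
    (forall X, D X -> D' X) -> forall X, D' X -> D X.

End Triangles.

(* Main.v *)
Require Import Defs.
From HB Require Import structures.
From mathcomp Require Import all_boot all_algebra all_field.
From mathcomp Require Import generic_quotient ring_quotient.
From mathcomp Require Import boolp classical_sets.

Set Implicit Arguments.
Unset Strict Implicit.
Unset Printing Implicit Defensive.

(* The last import restores the categorical meaning of [hom]. *)
Import GRing.Theory VectorInternalTheory Defs.
Local Open Scope ring_scope.
Local Open Scope quotient_scope.

(** A module all of whose stable maps from simple modules vanish is stably zero
    (lemma [stably_zero_of_simples]).  Indeed, if a map is stably zero on a
    submodule, then that restriction factors through a free module of finite
    rank, which is injective as the algebra is selfinjective; so the map can be
    corrected by a stably zero map to vanish on the submodule.  If the submodule
    is maximal, what is left factors through the inclusion of a zero or simple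
    image.  Hence every nonzero object of the stable category receives a nonzero
    map from a simple module.

    Let [D] be an abelian full subcategory containing the simple modules.  If
    [m : Y -> S] is a monomorphism of [D] with [S] a simple module and [Y]
    nonzero, choose a nonzero [T -> Y] with [T] simple; its composite with [m]
    is nonzero, so it comes from a nonzero map of simple modules, and Schur's
    lemma turns [m] into a split epimorphism, hence an isomorphism.
    Conversely, a simple object of [D] receives a nonzero map from a simple
    module, which is itself a simple object, and Schur's lemma in [D] applies.

    For the existence of a maximal [D], Zorn's lemma is applied to the
    distinguished abelian subcategories containing the simple modules.  The
    union of a chain is again one because an inclusion of two such
    subcategories is exact: a kernel [K] of [f] vanishes once there is no
    nonzero map to it from a simple module, so monomorphisms are the same in
    both; and a short exact sequence of the smaller one, being part of an exact
    triangle, has the lifting properties of a kernel and of a cokernel against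
    all objects, so it stays exact ([short_exact_incl]).  A starting point is
    the class of semisimple modules: there all maps are von Neumann regular, so
    the full subcategory on it is abelian with split short exact sequences, and
    split sequences are parts of triangles.  A triangle is formed with a chosen
    injective envelope, so the existence of injective envelopes has to be proved
    first; they are cut out of the coinduced modules [Hom_k(A, k^n)]. *)

(** * Submodules, images and quotients *)

Section Submodule.
Variables (R : nzRingType) (V : lmodType R) (N : {pred V}).

(** Indexing the predicate by the closure proof lets the algebraic structure of
    submodules and quotients be inferred. *)
Definition submod_pred of GRing.submod_closed N : {pred V} := N.

Variable hN : GRing.submod_closed N.

Lemma submod_pred_closed : GRing.submod_closed (submod_pred hN).
Proof. exact: hN. Qed.

HB.instance Definition _ :=
  GRing.isSubmodClosed.Build R V (submod_pred hN) submod_pred_closed.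

Record submodule := Submodule { submod_val : V; _ : submod_val \in submod_pred hN }.

HB.instance Definition _ := [isSub for submod_val].
HB.instance Definition _ := [Choice of submodule by <:].
HB.instance Definition _ := [SubChoice_isSubLmodule of submodule by <:].

Lemma submod_val_linear : linear submod_val.
Proof. by []. Qed.

Definition submod_incl : {linear submodule -> V} := mk_linear submod_val_linear.

Lemma submod_incl_inj : injective submod_incl.
Proof. exact: val_inj. Qed.

Lemma submod_inclP (u : submodule) : submod_incl u \in N.
Proof. exact: valP u. Qed.

Lemma submod_inclK x : x \in N -> exists u : submodule, submod_incl u = x.
Proof. by move=> h; exists (Submodule h). Qed.

End Submodule.

Section Quotient.
Variables (R : nzRingType) (V : lmodType R) (N : {pred V}).
Variable hN : GRing.submod_closed N.

Definition quotient_module := {ideal_quot (submod_pred hN : zmodClosed V)}.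
HB.instance Definition _ := GRing.Zmodule.on quotient_module.

Definition quotient_pi (x : V) : quotient_module :=
  \pi_{ideal_quot (submod_pred hN : zmodClosed V)} x.

Lemma quotient_piK q : exists x, quotient_pi x = q.
Proof. by exists (repr q); rewrite /quotient_pi reprK. Qed.

Lemma quotient_eq (x y : V) : quotient_pi x = quotient_pi y <-> x - y \in N.
Proof.
have E := Quotient.idealrBE (submod_pred hN : zmodClosed V) x y.
by split=> [/eqP|h]; [rewrite -E|apply/eqP; rewrite -E].
Qed.

Definition quotient_scale (a : R) (q : quotient_module) : quotient_module :=
  quotient_pi (a *: repr q).

Lemma quotient_scaleE a x : quotient_scale a (quotient_pi x) = quotient_pi (a *: x).
Proof.
apply/quotient_eq; rewrite -scalerBr.
have /quotient_eq h : quotient_pi (repr (quotient_pi x)) = quotient_pi x.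
  by rewrite /quotient_pi reprK.
by have [h0 hl] := hN; rewrite -[a *: _]addr0; apply: hl.
Qed.

Lemma quotient_piD x y : quotient_pi (x + y) = quotient_pi x + quotient_pi y.
Proof. by rewrite /quotient_pi piE. Qed.

Lemma quotient_scaleA a b q :
  quotient_scale a (quotient_scale b q) = quotient_scale (a * b) q.
Proof.
have [x <-] := quotient_piK q.
by rewrite (quotient_scaleE b) (quotient_scaleE a) (quotient_scaleE (a * b)) scalerA.
Qed.
Lemma quotient_scale1 : left_id 1 quotient_scale.
Proof.
move=> q; have [x <-] := quotient_piK q.
by rewrite quotient_scaleE scale1r.
Qed.
Lemma quotient_scaleDr : right_distributive quotient_scale +%R.
Proof.
move=> a p q.
have [x <-] := quotient_piK p.
have [y <-] := quotient_piK q.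
rewrite -quotient_piD (quotient_scaleE a x) (quotient_scaleE a y).
by rewrite (quotient_scaleE a (x + y)) -quotient_piD scalerDr.
Qed.
Lemma quotient_scaleDl q : {morph quotient_scale^~ q : a b / a + b}.
Proof.
move=> a b /=.
have [x <-] := quotient_piK q.
rewrite (quotient_scaleE a x) (quotient_scaleE b x).
by rewrite (quotient_scaleE (a + b) x) -quotient_piD scalerDl.
Qed.

HB.instance Definition _ := GRing.Zmodule_isLmodule.Build R quotient_module
  quotient_scaleA quotient_scale1 quotient_scaleDr quotient_scaleDl.

Lemma quotient_pi_linear : linear quotient_pi.
Proof. by move=> a x y; rewrite quotient_piD -quotient_scaleE. Qed.

Definition quotient_proj : {linear V -> quotient_module} :=
  mk_linear quotient_pi_linear.

Lemma quotient_proj_eq0 x : quotient_proj x = 0 <-> x \in N.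
Proof. by rewrite -(linear0 quotient_proj) quotient_eq subr0. Qed.

Lemma quotient_proj_surj q : exists x, quotient_proj x = q.
Proof. exact: quotient_piK. Qed.

End Quotient.

Section KernelImage.
Variables (R : nzRingType) (U V : lmodType R) (f : {linear U -> V}).

Definition kernel_pred : {pred U} := [pred x | f x == 0].
Definition image_pred : {pred V} := [pred y | `[< exists x, f x = y >]].

Lemma kernel_predP x : reflect (f x = 0) (x \in kernel_pred).
Proof. exact: eqP. Qed.

Lemma image_predP y : reflect (exists x, f x = y) (y \in image_pred).
Proof. exact: asboolP. Qed.

Lemma kernel_pred_closed : GRing.submod_closed kernel_pred.
Proof.
split=> [|a x y]; first by apply/kernel_predP; rewrite linear0.
move=> /kernel_predP hx /kernel_predP hy; apply/kernel_predP.
by rewrite linearP hx hy scaler0 addr0.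
Qed.

Lemma image_pred_closed : GRing.submod_closed image_pred.
Proof.
split; first by apply/image_predP; exists 0; rewrite linear0.
move=> a _ _ /image_predP[x <-] /image_predP[y <-].
by apply/image_predP; exists (a *: x + y); rewrite linearP.
Qed.

Lemma linear_injective : (forall x, f x = 0 -> x = 0) -> injective f.
Proof.
move=> h x y e; apply/eqP; rewrite -subr_eq0; apply/eqP/h.
by rewrite linearB e subrr.
Qed.

End KernelImage.

Lemma factor_surj (R : nzRingType) (V W T : lmodType R)
    (p : {linear V -> W}) (q : {linear V -> T}) :
  (forall z, exists y, p y = z) -> (forall y, p y = 0 -> q y = 0) ->
  exists w : {linear W -> T}, forall y, w (p y) = q y.
Proof.
move=> sp hk; have [s hs] := choice sp.
have e y y' : p y = p y' -> q y = q y'.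
  move=> h; apply/eqP; rewrite -subr_eq0 -linearB; apply/eqP/hk.
  by rewrite linearB h subrr.
have l : linear (fun z => q (s z)).
  by move=> a x y; rewrite -linearP; apply: e; rewrite linearP !hs.
by exists (mk_linear l) => y /=; apply: e.
Qed.

Lemma factor_inj (R : nzRingType) (U V T : lmodType R)
    (i : {linear U -> V}) (q : {linear T -> V}) :
  injective i -> (forall t, exists x, i x = q t) ->
  exists w : {linear T -> U}, forall t, i (w t) = q t.
Proof.
move=> ii hq; have [s hs] := choice hq.
have l : linear s by move=> a x y; apply: ii; rewrite !linearP !hs linearP.
by exists (mk_linear l).
Qed.

(** * Finiteness over the ground field *)

Lemma ex_maximal (T : Type) (P : T -> Prop) (mu : T -> nat) (b : nat) :
  (exists x, P x) -> (forall x, P x -> (mu x <= b)%N) ->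
  exists2 x, P x & forall y, P y -> (mu y <= mu x)%N.
Proof.
move=> [x0 Px0] hb.
pose p := [pred n | `[< exists2 x, P x & mu x = n >]].
have ep : exists n, p n by exists (mu x0); apply/asboolP; exists x0.
have bp n : p n -> (n <= b)%N by move=> /asboolP[x Px <-]; exact: hb.
case: (ex_maxnP ep bp) => n /asboolP[x Px <-] hm.
by exists x => // y Py; apply: hm; apply/asboolP; exists y.
Qed.

(** Among the matrices whose row space lies in [P], take one of maximal rank. *)
Lemma rowspace_of_pred (k : fieldType) (m : nat) (P : {pred 'rV[k]_m}) :
  GRing.submod_closed P ->
  exists B : 'M[k]_m, forall u : 'rV_m, (u <= B)%MS = (u \in P).
Proof.
move=> [P0 Pl].
have hP0 : forall u : 'rV_m, (u <= (0 : 'M[k]_m))%MS -> u \in P.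
  by move=> u; rewrite submx0 => /eqP ->.
have [||B hB hmax] := @ex_maximal 'M[k]_m
  (fun B => forall u : 'rV_m, (u <= B)%MS -> u \in P) (fun B => \rank B) m.
- by exists 0.
- by move=> B _; exact: rank_leq_col.
exists B => u; apply/idP/idP; first exact: hB.
move=> uP; apply: contraT => uB.
have hS : forall v : 'rV_m, (v <= u + B)%MS -> v \in P.
  move=> v /sub_addsmxP[[c D] /= ->].
  by rewrite (mx11_scalar c) mul_scalar_mx; apply: Pl => //; apply: hB; exact: submxMl.
have := hmax _ hS; rewrite leqNgt; case/negP; apply: rank_ltmx.
rewrite /ltmx addsmxSr /=; apply: contra uB => h.
exact: submx_trans (addsmxSl u B) h.
Qed.

Section GroundField.
Variables (k : fieldType) (A : falgType k).
Implicit Types V : lmodType A.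

Definition klinear_map V m (phi : 'rV[k]_m -> V) : Prop :=
  forall c u v, phi (c *: u + v) = c%:A *: phi u + phi v.

Lemma klinear0 V m (phi : 'rV[k]_m -> V) : klinear_map phi -> phi 0 = 0.
Proof.
move=> h; have := h (-1) 0 0; rewrite !scaler0 addr0.
by rewrite scaleN1r scaleN1r addNr.
Qed.

Lemma fg_kspan V : finitely_generated V ->
  exists (m : nat) (phi : 'rV[k]_m -> V),
    klinear_map phi /\ forall x, exists u, phi u = x.
Proof.
move=> [n [g hg]].
pose phi (u : 'rV[k]_(n * dim A)) : V :=
  \sum_(i < n) (@r2v k A (row i (vec_mx u))) *: g i.
exists (n * dim A)%N, phi; split.
  move=> c u v; rewrite scaler_sumr -big_split; apply: eq_bigr => i _ /=.
  by rewrite !linearP /= scalerDl scalerA mulr_algl.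
move=> x; have [c ->] := hg x.
exists (mxvec (\matrix_i v2r (c i))); apply: eq_bigr => i _.
by rewrite mxvecK rowK v2rK.
Qed.

Lemma submod_rowspace V m (phi : 'rV[k]_m -> V) (N : {pred V}) :
  klinear_map phi -> GRing.submod_closed N ->
  exists B : 'M[k]_m, forall u : 'rV_m, (u <= B)%MS = (phi u \in N).
Proof.
move=> hphi [N0 Nl].
have [|B hB] := @rowspace_of_pred k m [pred u | phi u \in N].
  split=> [|c u v]; first by rewrite inE klinear0.
  by rewrite !inE hphi; apply: Nl.
by exists B => u; rewrite hB.
Qed.

(** The measure is the dimension over [k] of the preimage in coordinates; it
    replaces the length of a module in the inductions and extremal choices
    below. *)
Lemma submod_measure V : finitely_generated V ->
  exists (d : {pred V} -> nat) (b : nat),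
    (forall N, GRing.submod_closed N -> (d N <= b)%N) /\
    (forall N N' : {pred V}, GRing.submod_closed N -> GRing.submod_closed N' ->
      {subset N <= N'} -> {subset N' <= N} \/ (d N < d N')%N).
Proof.
move=> /fg_kspan[m [phi [hphi sphi]]].
have /choice[B hB] : forall N : {pred V}, exists B : 'M[k]_m,
    GRing.submod_closed N -> forall u : 'rV_m, (u <= B)%MS = (phi u \in N).
  move=> N; have [hN|hN] := pselect (GRing.submod_closed N).
    by have [B hB] := submod_rowspace hphi hN; exists B.
  by exists 0.
exists (fun N => \rank (B N)), m; split=> [N _|N N' hN hN' s].
  exact: rank_leq_col.
have sB : (B N <= B N')%MS.
  by apply/row_subP => i; rewrite hB //; apply: s; rewrite -hB // row_sub.
have [h|h] := boolP (B N' <= B N)%MS; [left=> x|right].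
  have [u <-] := sphi x; rewrite -!hB // => hu; exact: submx_trans hu h.
by apply: rank_ltmx; rewrite /ltmx sB.
Qed.

(** Noetherianity: the images of the rows of a matrix spanning the preimage in
    coordinates are generators. *)
Lemma submod_fg V (N : {pred V}) (hN : GRing.submod_closed N) :
  finitely_generated V -> finitely_generated (submodule hN).
Proof.
move=> /fg_kspan[m [phi [hphi sphi]]].
have [B hB] := submod_rowspace hphi hN.
have hg i : exists y : submodule hN, submod_incl hN y = phi (row i B).
  by apply: submod_inclK; rewrite -hB row_sub.
have [g hg'] := choice hg.
exists m, g => x.
have [u hu] := sphi (submod_incl hN x).
have /submxP[c hc] : (u <= B)%MS by rewrite hB hu; exact: submod_inclP.
exists (fun i => (c 0 i)%:A); apply: (@submod_incl_inj _ _ _ hN).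
rewrite -hu hc linear_sum mulmx_sum_row.
have -> : forall (s : seq 'I_m) , phi (\sum_(i <- s) c 0 i *: row i B) =
   \sum_(i <- s) (c 0 i)%:A *: phi (row i B).
  elim=> [|i s IH]; first by rewrite !big_nil klinear0.
  by rewrite !big_cons hphi IH.
by apply: eq_bigr => i _; rewrite linearZ hg'.
Qed.

Definition fgsubmodule (V : fgmodule A) (N : {pred V})
    (hN : GRing.submod_closed N) : fgmodule A :=
  FGModule (submod_fg hN (fgmod_fg V)).

End GroundField.

Lemma image_fg (R : nzRingType) (V W : lmodType R) (p : {linear V -> W}) :
  (forall z, exists y, p y = z) -> finitely_generated V -> finitely_generated W.
Proof.
move=> sp [n [g hg]]; exists n, (fun i => p (g i)) => z.
have [y <-] := sp z; have [c ->] := hg y; exists c.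
by rewrite linear_sum; apply: eq_bigr => i _; rewrite linearZ.
Qed.

Definition fgquotient (R : nzRingType) (V : fgmodule R) (N : {pred V})
    (hN : GRing.submod_closed N) : fgmodule R :=
  FGModule (image_fg (@quotient_proj_surj _ _ _ hN) (fgmod_fg V)).

(** * Maps that vanish in the stable category *)

Section FreeModules.
Variables (A : nzRingType).

Lemma free_map_linear (V : lmodType A) n (g : 'I_n -> V) :
  linear (fun u : 'rV[A]_n => \sum_i u 0 i *: g i).
Proof.
move=> a u v; rewrite scaler_sumr -big_split; apply: eq_bigr => i _ /=.
by rewrite !mxE scalerDl scalerA.
Qed.

Definition free_map (V : lmodType A) n (g : 'I_n -> V) :
  {linear 'rV[A]_n -> V} := mk_linear (free_map_linear g).

Lemma free_projective n : projective_module ('rV[A]_n : lmodType A).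
Proof.
move=> M N g f sg; have [s hs] := choice sg.
exists (free_map (fun i => s (f (delta_mx 0 i)))) => u.
rewrite [in RHS](row_sum_delta u) !linear_sum; apply: eq_bigr => i _.
by rewrite !linearZ hs.
Qed.

Lemma free_injective n : selfinjective A -> injective_module ('rV[A]_n : lmodType A).
Proof.
move=> hA M N i f ii.
have lf j : linear (fun x => f x 0 j : A^o).
  by move=> a x y; rewrite linearP !mxE.
have /choice[h hh] : forall j, exists h : {linear N -> A^o},
    forall x, h (i x) = f x 0 j.
  by move=> j; have [h hh] := hA M N i (mk_linear (lf j)) ii; exists h.
have l : linear (fun y => \row_j h j y : 'rV[A]_n).
  by move=> a x y; apply/rowP => j; rewrite !mxE linearP.
by exists (mk_linear l) => x; apply/rowP => j; rewrite mxE hh.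
Qed.

Lemma fg_free_cover (V : lmodType A) : finitely_generated V ->
  exists n (p : {linear 'rV[A]_n -> V}), forall x, exists u, p u = x.
Proof.
move=> [n [g hg]]; exists n, (free_map g) => x.
have [c ->] := hg x; exists (\row_i c i).
by apply: eq_bigr => i _; rewrite mxE.
Qed.

End FreeModules.

Section StableZero.
Variable A : nzRingType.
Implicit Types U V W X : fgmodule A.

Lemma factors_comp U V W X (g : {linear V -> W}) (f : {linear U -> V})
    (h : {linear X -> U}) :
  factors_through_projective f ->
  factors_through_projective (g \o f \o h : {linear X -> W}).
Proof.
move=> [P [u [v [hP e]]]].
exists P, (u \o h : {linear X -> P}), (g \o v : {linear P -> W}).
by split=> // x /=; rewrite e.
Qed.

Lemma factors_ext U V (f g : {linear U -> V}) : f =1 g ->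
  factors_through_projective f -> factors_through_projective g.
Proof. by move=> /linear_ext ->. Qed.

Lemma stable0 U V : stable (0 : mhom U V) = 0.
Proof.
by have := stableD (0 : mhom U V) 0; rewrite addr0 => /eqP; rewrite eq_sym
  -subr_eq0 addrK => /eqP.
Qed.

Lemma stable_eq0 U V (f : mhom U V) :
  stable f = 0 <-> factors_through_projective f.
Proof. by rewrite -(stable0 U V) stable_eq subr0. Qed.

Lemma stableN U V (f : mhom U V) : stable (- f) = - stable f.
Proof. by apply/eqP; rewrite -addr_eq0 -stableD addNr stable0. Qed.

Lemma factors0 U V : factors_through_projective (\0 : {linear U -> V}).
Proof. by apply/(stable_eq0 (0 : mhom U V)); exact: stable0. Qed.

Lemma factorsD U V (f g : mhom U V) : factors_through_projective f ->
  factors_through_projective g -> factors_through_projective (f + g : mhom U V).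
Proof.
move=> /stable_eq0 hf /stable_eq0 hg; apply/stable_eq0.
by rewrite stableD hf hg addr0.
Qed.

(** A map that factors through any projective factors through a finitely
    generated free module, which selfinjectivity makes injective. *)
Lemma factors_extend U V X (i : {linear U -> V}) (f : {linear U -> X}) :
  selfinjective A -> injective i -> factors_through_projective f ->
  exists2 f' : {linear V -> X}, factors_through_projective f' &
    forall x, f' (i x) = f x.
Proof.
move=> hA ii [P [u [v [hP e]]]].
have [n [p sp]] := fg_free_cover (fgmod_fg X).
have [w hw] := hP _ _ p v sp.
have [t ht] := free_injective (n := n) hA (w \o u : {linear U -> 'rV[A]_n}) ii.
exists (p \o t : {linear V -> X}) => [|x]; last by rewrite /= ht /= hw e.
by exists ('rV[A]_n : lmodType A), t, p; split=> //; exact: free_projective.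
Qed.

End StableZero.

Section SocleTest.
Variables (k : fieldType) (A : falgType k).
Hypothesis hself : selfinjective A.

(** An object of the stable category with no nonzero map from a simple module
    is zero.  Maps from all submodules of [X] to [X] are treated by induction.
    Once [h : N -> X] is stably zero on a maximal submodule of [N], subtracting
    an extension of that restriction leaves a map with zero or simple image. *)
Lemma stably_zero_of_simples (X : fgmodule A) :
  (forall (T : fgmodule A) (f : {linear T -> X}), simple_module T ->
     factors_through_projective f) ->
  factors_through_projective (idfun : {linear X -> X}).
Proof.
move=> hX; have [d [b [hb hd]]] := submod_measure (fgmod_fg X).
have zero_closed : GRing.submod_closed (pred1 (0 : X)).
  split=> [|a x y]; rewrite !inE // => /eqP -> /eqP ->.
  by rewrite scaler0 addr0.
suff main n (N : {pred X}) (hN : GRing.submod_closed N) :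
    (d N < n)%N -> forall h : {linear fgsubmodule hN -> X},
    factors_through_projective h.
  have hT : GRing.submod_closed (predT : {pred X}) by [].
  have [t ht] : exists t : {linear X -> fgsubmodule hT},
      forall x, submod_incl hT (t x) = x.
    apply: (factor_inj (q := idfun : {linear X -> X})).
      exact: submod_incl_inj.
    by move=> x; apply: submod_inclK.
  have := factors_comp idfun t (main _ _ hT (leqnn _) (submod_incl hT)).
  by apply: factors_ext => x; exact: ht.
elim: n N hN => // n IH N hN hn h.
have [N0|/existsNP[x0 /not_implyP[x0N /eqP x0n]]] :=
    pselect (forall x, x \in N -> x = 0).
  apply: (factors_ext (f := \0 : {linear fgsubmodule hN -> X})) (factors0 _ _).
  move=> x; have -> : x = 0.
    by apply: (@submod_incl_inj _ _ _ hN); rewrite linear0; apply/N0/submod_inclP.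
  by rewrite !linear0.
have [||N' [hN' sN' [x xN xN']] hmax] := @ex_maximal {pred X} (fun N' =>
  [/\ GRing.submod_closed N', {subset N' <= N} &
     exists2 x, x \in N & x \notin N']) d b.
- exists (pred1 (0 : X) : {pred X}); split=> //; last by exists x0.
  by move=> y /eqP ->; have [] := hN.
- by move=> N' [? _ _]; exact: hb.
have dN' : (d N' < n)%N.
  have [h1|h1] := hd _ _ hN' hN sN'; first by rewrite h1 in xN'.
  exact: leq_trans h1 hn.
have [j hj] : exists j : {linear fgsubmodule hN' -> fgsubmodule hN},
    forall y, submod_incl hN (j y) = submod_incl hN' y.
  apply: factor_inj; first exact: submod_incl_inj.
  by move=> y; apply: submod_inclK; apply: sN'; exact: submod_inclP.
have ij : injective j.
  by move=> y y' e; apply: (@submod_incl_inj _ _ _ hN'); rewrite -!hj e.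
have [f' ff' hf'] := factors_extend hself ij
   (IH _ hN' dN' (h \o j : {linear fgsubmodule hN' -> X})).
pose h' : mhom (fgsubmodule hN) X :=
  (h : mhom (fgsubmodule hN) X) - (f' : mhom (fgsubmodule hN) X).
suff fh' : factors_through_projective h'.
  apply: (factors_ext _ (factorsD ff' fh')) => y /=.
  by rewrite addrC subrK.
have h'j y : h' (j y) = 0 by rewrite /= hf' subrr.
pose T := image_pred h'; have hT : GRing.submod_closed T := image_pred_closed h'.
have [w hw] : exists w : {linear fgsubmodule hN -> fgsubmodule hT},
    forall y, submod_incl hT (w y) = h' y.
  apply: factor_inj; first exact: submod_incl_inj.
  by move=> y; apply: submod_inclK; apply/image_predP; exists y.
have sw t : exists y, w y = t.
  have /image_predP[y hy] := submod_inclP t.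
  by exists y; apply: (@submod_incl_inj _ _ _ hT); rewrite hw.
have [h'0|/existsNP[y0 hy0]] := pselect (forall y, h' y = 0).
  apply: (factors_ext (f := \0 : {linear fgsubmodule hN -> X})) (factors0 _ _).
  by move=> y; rewrite (h'0 y).
suff simT : simple_module (fgsubmodule hT).
  have := factors_comp (idfun : {linear X -> X}) w
    (hX (fgsubmodule hT) (submod_incl hT) simT).
  by apply: factors_ext => y; exact: hw.
split; first by exists (w y0); apply/eqP => e; apply: hy0; rewrite -hw e linear0.
move=> L [L0 Ll].
pose Q : {pred X} := [pred x | `[< exists2 y, submod_incl hN y = x & w y \in L >]].
have hQ : GRing.submod_closed Q.
  split; first by apply/asboolP; exists 0; rewrite linear0.
  move=> a _ _ /asboolP[y <- hy] /asboolP[y' <- hy'].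
  by apply/asboolP; exists (a *: y + y'); rewrite linearP //; apply: Ll.
have sNQ : {subset N' <= Q}.
  move=> y yN'; have [y' <-] := submod_inclK hN' yN'.
  apply/asboolP; exists (j y'); first exact: hj.
  have -> : w (j y') = 0; last by [].
  by apply: (@submod_incl_inj _ _ _ hT); rewrite hw h'j linear0.
have sQN : {subset Q <= N}.
  by move=> _ /asboolP[y <- _]; exact: submod_inclP.
have [NQ|/existsNP[z /not_implyP[zN /negP zQ]]] := pselect {subset N <= Q}.
  right=> t; have [y <-] := sw t.
  have /asboolP[y' e hy'] := NQ _ (submod_inclP y).
  by rewrite -(submod_incl_inj e).
left=> t tL; have [y hy] := sw t.
have [QN'|] := hd _ _ hN' hQ sNQ; last first.
  have/hmax : [/\ GRing.submod_closed Q, {subset Q <= N} &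
     exists2 x, x \in N & x \notin Q] by split=> //; exists z.
  by rewrite leqNgt => /negP.
have yQ : submod_incl hN y \in Q by apply/asboolP; exists y; rewrite ?hy.
have [y' hy'] := submod_inclK hN' (QN' _ yQ).
have ejy : j y' = y by apply: (@submod_incl_inj _ _ _ hN); rewrite hj.
by apply: (@submod_incl_inj _ _ _ hT); rewrite -hy hw -ejy h'j linear0.
Qed.

End SocleTest.

(** * Injective envelopes *)

Section Coinduced.
Variables (k : fieldType) (A : falgType k).

(** A maximal [k]-subspace [L] meeting [i M] trivially is a complement of it. *)
Lemma k_retraction (M N : lmodType A) (i : {linear M -> N}) : injective i ->
  exists rho : N -> M, (forall c x y, rho (c%:A *: x + y) = c%:A *: rho x + rho y)
    /\ forall m, rho (i m) = m.
Proof.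
move=> ii.
pose P : set (set N) := [set L | (forall (c : k) x y, L x -> L y ->
  L (c%:A *: x + y)) /\ forall m, L (i m) -> m = 0]%classic.
have [F FP Fch|L [[Ll Lt] Lmax]] := @Zorn_bigcup N P.
  split=> [c x y [L FL Lx] [L' FL' L'y]|m [L FL]]; last by have [_] := FP _ FL; apply.
  have [LL|LL] := Fch _ _ FL FL'.
    by exists L' => //; have [h _] := FP _ FL'; apply: h => //; exact: LL.
  by exists L => //; have [h _] := FP _ FL; apply: h => //; exact: LL.
have L0 : L 0.
  have [L0|nL0] := pselect (L 0); first exact: L0.
  exfalso.
  pose L' := (L `|` [set 0])%classic.
  have LL' : (L `<` L')%classic.
    by split=> [x Lx|h]; [left|apply: nL0; apply: h; right].
  apply: (Lmax _ LL'); split=> [c x y [Lx|->] [Ly|->]|m [/Lt//|h]].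
  - by left; exact: Ll.
  - exfalso; apply: nL0; have := Ll (-1) _ _ Lx Lx.
    by rewrite scaleN1r scaleN1r addNr.
  - by left; rewrite scaler0 add0r.
  - by right; rewrite scaler0 addr0.
  - by apply: ii; rewrite linear0.
(* Otherwise [L + k x] would be a larger subspace meeting [i M] trivially. *)
have dec x : exists m, L (x - i m).
  have [h|hx] := pselect (exists m, L (x - i m)); first exact: h.
  exfalso.
  pose L' : set N := [set y | exists2 c : k, L (y - c%:A *: x) & True]%classic.
  have LL' : (L `<` L')%classic.
    split=> [y Ly|h]; first by exists 0; rewrite // !scale0r subr0.
    apply: hx; exists 0; rewrite linear0 subr0; apply: h; exists 1 => //.
    by rewrite !scale1r subrr.
  apply: (Lmax _ LL'); split=> [c y z [a ha _] [b hb _]|m [c hc _]].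
    exists (c * a + b) => //; have := Ll c _ _ ha hb; congr L.
    rewrite scalerBr addrACA -opprD; congr (_ - _).
    by rewrite scalerA -scalerAl mul1r scalerA -scalerDl -scalerDl.
  have [c0|c0] := eqVneq c 0; first by apply: Lt; rewrite c0 !scale0r subr0 in hc.
  exfalso; apply: hx; exists (c^-1%:A *: m).
  have := Ll (- c^-1) _ _ hc L0; rewrite addr0; congr L.
  rewrite [i (_ *: _)]linearZ_LR scalerBr !scaleNr opprK scalerA -scalerAl mul1r.
  by rewrite scalerA mulVf // !scale1r addrC.
have [rho hrho] := choice dec.
have uniq x m : L (x - i m) -> rho x = m.
  move=> h; apply/eqP; rewrite -subr_eq0; apply/eqP; apply: Lt.
  have := Ll (-1) _ _ (hrho x) h; congr L.
  by rewrite scaleN1r scaleN1r [i (_ - _)]linearB opprB addrA subrK.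
exists rho; split=> [c x y|m]; last by apply: uniq; rewrite subrr.
apply: uniq; have := Ll c _ _ (hrho x) (hrho y); congr L.
by rewrite linearP scalerBr opprD addrACA.
Qed.

(** The module [Hom_k(A, k^n)], on which [a] acts by precomposition with right
    multiplication by [a]; for [n = 1] it is the dual of the right regular
    module. *)
Definition coinduced n : Type := 'Hom(A, 'rV[k]_n).

Section Action.
Variable n : nat.
HB.instance Definition _ := GRing.Zmodule.on (coinduced n).

Definition coinduced_scale (a : A) (phi : coinduced n) : coinduced n :=
  ((phi : 'Hom(A, 'rV[k]_n)) \o amulr a)%VF.

Lemma coinduced_scaleE a phi b :
  (coinduced_scale a phi : 'Hom(A, 'rV[k]_n)) b =
  (phi : 'Hom(A, 'rV[k]_n)) (b * a).
Proof. by rewrite comp_lfunE lfunE. Qed.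

Lemma coinduced_scaleA a b phi :
  coinduced_scale a (coinduced_scale b phi) = coinduced_scale (a * b) phi.
Proof. by apply/lfunP => x; rewrite !coinduced_scaleE mulrA. Qed.
Lemma coinduced_scale1 : left_id 1 coinduced_scale.
Proof. by move=> phi; apply/lfunP => x; rewrite coinduced_scaleE mulr1. Qed.
Lemma coinduced_scaleDr : right_distributive coinduced_scale +%R.
Proof.
move=> a f g; apply/lfunP => x.
by rewrite coinduced_scaleE !add_lfunE !coinduced_scaleE.
Qed.
Lemma coinduced_scaleDl phi : {morph coinduced_scale^~ phi : a b / a + b}.
Proof.
move=> a b; apply/lfunP => x.
by rewrite add_lfunE !coinduced_scaleE mulrDr linearD.
Qed.

HB.instance Definition _ := GRing.Zmodule_isLmodule.Build A (coinduced n)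
  coinduced_scaleA coinduced_scale1 coinduced_scaleDr coinduced_scaleDl.

Definition ceval (phi : coinduced n) : A -> 'rV[k]_n := phi : 'Hom(A, 'rV[k]_n).

Lemma cevalP (f g : coinduced n) : ceval f =1 ceval g -> f = g.
Proof. by move=> h; apply/lfunP. Qed.

Lemma ceval_linear a phi psi b :
  ceval (a *: phi + psi) b = ceval phi (b * a) + ceval psi b.
Proof. by rewrite /ceval add_lfunE -coinduced_scaleE. Qed.

Lemma ceval_exists (f : A -> 'rV[k]_n) : linear f -> exists phi, ceval phi =1 f.
Proof.
move=> lf.
pose g : {linear A -> 'rV[k]_n} := HB.pack f (GRing.isLinear.Build _ _ _ _ f lf).
exists (linfun g); by move=> x; rewrite /ceval lfunE.
Qed.

(** Evaluation at [1] identifies [A]-maps into the coinduced module with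
    [k]-linear maps into [k^n], and these extend along [k]-retractions. *)
Lemma coinduced_injective : injective_module (coinduced n : lmodType A).
Proof.
move=> M N i f ii; have [rho [rhol rhoK]] := k_retraction ii.
have /choice[F hF] : forall x, exists phi : coinduced n,
    ceval phi =1 fun b => ceval (f (rho (b *: x))) 1.
  move=> x; apply: ceval_exists => c a b.
  have -> : (c *: a + b) *: x = c%:A *: (a *: x) + b *: x.
    by rewrite scalerDl scalerA mulr_algl.
  rewrite rhol linearP ceval_linear mul1r; congr (_ + _).
  by rewrite /ceval -linearZ.
have lF : linear F.
  move=> a x y; apply: cevalP => b.
  rewrite ceval_linear !hF scalerDr scalerA.
  have := rhol 1 ((b * a) *: x) (b *: y); rewrite !scale1r => ->.
  rewrite linearD.
  by have := ceval_linear 1 (f (rho ((b * a) *: x))) (f (rho (b *: y))) 1;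
    rewrite scale1r mulr1.
exists (mk_linear lF) => m; apply: cevalP => b /=.
rewrite hF -linearZ rhoK linearZ.
by have := ceval_linear b (f m) 0 1; rewrite addr0 mul1r => ->;
  rewrite /ceval zero_lfunE addr0.
Qed.

Lemma coinduced_fg : finitely_generated (coinduced n : lmodType A).
Proof.
pose U : vectType k := 'Hom(A, 'rV[k]_n).
exists (dim U), (fun i => r2v (delta_mx 0 i) : U) => phi.
exists (fun i => (v2r (phi : U) 0 i)%:A).
rewrite -[phi in LHS](@v2rK k U) [in LHS](row_sum_delta (v2r _)) linear_sum.
apply: eq_bigr => i _; apply: cevalP => b.
have := ceval_linear (v2r (phi : U) 0 i)%:A (r2v (delta_mx 0 i) : U) 0 b.
rewrite addr0 => ->.
by rewrite /ceval zero_lfunE addr0 linearZ scale_lfunE mulr_algr linearZ.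
Qed.

End Action.
End Coinduced.

Lemma retract_injective (R : nzRingType) (I E : lmodType R)
    (s : {linear E -> I}) (r : {linear I -> E}) :
  (forall x, r (s x) = x) -> injective_module I -> injective_module E.
Proof.
move=> rs hI M N i f ii.
have [h hh] := hI M N i (s \o f : {linear M -> I}) ii.
by exists (r \o h : {linear N -> E}) => x /=; rewrite hh /= rs.
Qed.

Section Envelopes.
Variables (k : fieldType) (A : falgType k).

(** A [k]-linear embedding [lam] of [V] into some [k^m] induces the embedding
    [x |-> (b |-> lam (b *: x))]. *)
Lemma fg_embeds (V : lmodType A) : finitely_generated V ->
  exists n (i : {linear V -> coinduced A n}), injective i.
Proof.
move=> /fg_kspan[m [phi [hphi sphi]]].
have N0 : GRing.submod_closed (pred1 (0 : V)).
  split=> [|a x y]; rewrite !inE // => /eqP -> /eqP ->.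
  by rewrite scaler0 addr0.
have [B hB] := submod_rowspace hphi N0.
have [s hs] := choice sphi.
pose lam x := s x *m cokermx B.
have hlam c x y : lam (c%:A *: x + y) = c *: lam x + lam y.
  apply/eqP; rewrite -subr_eq0 scalemxAl -mulmxDl -mulmxBl -submxE hB.
  rewrite inE; apply/eqP.
  have := hphi (-1) (c *: s x + s y) (s (c%:A *: x + y)).
  rewrite scaleN1r addrC => ->.
  by rewrite hphi !hs scaleN1r scaleN1r addNr.
have lam_inj x : lam x = 0 -> x = 0.
  by move=> /eqP; rewrite -submxE hB hs => /eqP.
have lam0 : lam 0 = 0.
  by have := hlam (-1) 0 0; rewrite scaler0 addr0 scaleN1r addNr.
have /choice[F hF] : forall x, exists f : coinduced A m,
    ceval f =1 fun b => lam (b *: x).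
  move=> x; apply: ceval_exists => c a b.
  by rewrite -hlam scalerDl scalerA mulr_algl.
have lF : linear F.
  move=> a x y; apply: cevalP => b.
  rewrite ceval_linear !hF scalerDr scalerA.
  by have := hlam 1 ((b * a) *: x) (b *: y); rewrite !scale1r.
exists m, (mk_linear lF); apply: linear_injective => x hx.
apply: lam_inj; have := hF x 1; rewrite scale1r => <-.
have -> : F x = 0 := hx.
by have := hF 0 1; rewrite scale1r lam0 => <-;
  rewrite -[F 0]/(mk_linear lF 0) linear0.
Qed.

(** Inside an injective module containing [X], take an endomorphism [e] fixing
    [X] with a kernel as large, and then an image as small, as possible.  Then
    [e] and [e \o e] have the same kernel and image, so the image of [e] is a
    direct summand; and if a nonzero submodule of the image met [X] trivially, an
    endomorphism killing it and fixing [X] would have a larger kernel. *)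
Lemma injective_envelope_exists (X : fgmodule A) :
  exists c : cosyzygy X, is_cosyzygy c.
Proof.
have [n [iota iota_inj]] := fg_embeds (fgmod_fg X).
pose I : fgmodule A := FGModule (coinduced_fg A n).
have injI : injective_module I := @coinduced_injective k A n.
have [d [b [hb hd]]] := submod_measure (fgmod_fg I).
pose P (e : {linear I -> I}) := forall x, e (iota x) = iota x.
pose K (e : {linear I -> I}) := d (kernel_pred e).
pose J (e : {linear I -> I}) := d (image_pred e).
have [||e0 Pe0 max0] := @ex_maximal _ P K b.
- by exists idfun.
- by move=> e _; apply: hb; exact: kernel_pred_closed.
have [||e [Pe Ke] maxe] := @ex_maximal _ (fun e => P e /\ K e = K e0)
  (fun e => (b - J e)%N) b.
- by exists e0.
- by move=> e _; exact: leq_subr.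
have maxK e' : P e' -> (K e' <= K e)%N by rewrite Ke; exact: max0.
have {maxe} minJ e' : P e' -> K e' = K e -> (J e <= J e')%N.
  move=> Pe' Ke'; have := maxe e' (conj Pe' (etrans Ke' Ke)).
  by rewrite leq_sub2lE //; apply: hb; exact: image_pred_closed.
have {}maxK (e' : {linear I -> I}) : P e' ->
    (forall x, e x = 0 -> e' x = 0) -> forall x, e' x = 0 -> e x = 0.
  move=> Pe' h x hx.
  have [|||s|h1] := hd (kernel_pred e) (kernel_pred e').
  - exact: kernel_pred_closed.
  - exact: kernel_pred_closed.
  - by move=> y /kernel_predP hy; apply/kernel_predP; exact: h.
  - by apply/kernel_predP; apply: s; apply/kernel_predP.
  - by have := maxK e' Pe'; rewrite leqNgt h1.
have eK : forall x, e (e x) = 0 -> e x = 0.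
  apply: (maxK (e \o e : {linear I -> I})) => [x|x hx] /=; first by rewrite !Pe.
  by rewrite hx linear0.
have eJ x : exists y, e (e y) = e x.
  have [|||s|h1] := hd (image_pred (e \o e : {linear I -> I})) (image_pred e).
  - exact: image_pred_closed.
  - exact: image_pred_closed.
  - by move=> _ /image_predP[y <-]; apply/image_predP; exists (e y).
  - have /s/image_predP[y hy] : e x \in image_pred e by apply/image_predP; exists x.
    by exists y.
  - have := minJ (e \o e : {linear I -> I}); rewrite leqNgt h1 => h; exfalso.
    suff : false by [].
    apply: h => [z|]; first by rewrite /= !Pe.
    congr (d _); apply/funext => z; rewrite /kernel_pred /=; apply/eqP/eqP => [/eK//|->].
    by rewrite linear0.
pose hE := image_pred_closed e; pose E := fgsubmodule hE.
have [w hw] : exists w : {linear I -> E}, forall x, submod_incl hE (w x) = e x.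
  apply: factor_inj; first exact: submod_incl_inj.
  by move=> x; apply: submod_inclK; apply/image_predP; exists x.
have sw t : exists x, w x = t.
  have /image_predP[x hx] := submod_inclP t.
  by exists x; apply: (@submod_incl_inj _ _ _ hE); rewrite hw.
have w0 x : w x = 0 <-> e x = 0.
  rewrite -hw; split=> [->|h]; first by rewrite linear0.
  by apply: (@submod_incl_inj _ _ _ hE); rewrite h linear0.
have wi_inj : injective (w \o submod_incl hE : {linear E -> E}).
  apply: linear_injective => t; have [x <-] := sw t.
  move=> h; apply/w0/eK; rewrite -[e x]hw; apply/w0; exact: h.
have [r hr] : exists r : {linear I -> E}, forall x,
    (w \o submod_incl hE : {linear E -> E}) (r x) = w x.
  apply: factor_inj => // x; have [y hy] := eJ x; exists (w y).
  apply: (@submod_incl_inj _ _ _ hE).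
  have -> : submod_incl hE (w x) = e (submod_incl hE (w y)) by rewrite !hw.
  exact: hw.
have rK t : r (submod_incl hE t) = t by apply: wi_inj; rewrite hr.
have injE : injective_module E := retract_injective rK injI.
have [i hi] : exists i : {linear X -> E}, forall x, submod_incl hE (i x) = iota x.
  apply: factor_inj; first exact: submod_incl_inj.
  by move=> x; apply: submod_inclK; apply/image_predP; exists (iota x).
have i_inj : injective i.
  by move=> x y h; apply: iota_inj; rewrite -!hi h.
have ess : essential i.
  move=> N hN hNX y yN.
  have l1 : linear (fun z : (X * submodule hN)%type => i z.1 + submod_incl hN z.2).
    by move=> a u v; rewrite /= !linearP scalerDr addrACA.
  have l2 : linear (fun z : (X * submodule hN)%type => iota z.1).
    by move=> a u v; rewrite /= linearP.
  have [|e0' he0'] := injI _ _ (mk_linear l1) (mk_linear l2).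
    apply: linear_injective => -[x u] /= h.
    have x0 : x = 0.
      apply: i_inj; rewrite linear0; apply: hNX.
      have -> : i x = -1 *: submod_incl hN u + 0.
        by rewrite scaleN1r addr0; apply/eqP; rewrite -addr_eq0 h.
      have [N0 Nl] := hN; apply: Nl => //; exact: submod_inclP.
    rewrite x0 linear0 add0r in h *; congr pair.
    by apply: (@submod_incl_inj _ _ _ hN); rewrite [RHS]linear0; exact: h.
  have wi x : w (iota x) = i x.
    by apply: (@submod_incl_inj _ _ _ hE); rewrite hw hi.
  have [z hz] := sw y.
  rewrite -hz; apply/w0; apply: (maxK (e0' \o w : {linear I -> I})) => [x|x /w0|] /=.
  - rewrite wi; have : e0' (i x + submod_incl hN 0) = iota x := he0' (x, 0).
    by rewrite linear0 addr0.
  - by move=> ->; rewrite linear0.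
  - have [u hu] := submod_inclK hN yN.
    have : e0' (i 0 + submod_incl hN u) = iota 0 := he0' (0, u).
    by rewrite !linear0 add0r hu -hz.
have hC := image_pred_closed i.
exists (@Cosyzygy _ X E (fgquotient hC) i (quotient_proj hC)); split=> //.
split=> //; last exact: quotient_proj_surj.
move=> y; split=> [/quotient_proj_eq0/image_predP|h] //.
by apply/quotient_proj_eq0/image_predP.
Qed.

Lemma chosen_cosyzygyP (X : fgmodule A) : is_cosyzygy (chosen_cosyzygy X).
Proof.
rewrite /chosen_cosyzygy; case: pselect => [h|[]]; last exact: injective_envelope_exists.
exact: proj2_sig (cid h).
Qed.

End Envelopes.

(** * Abelian full subcategories *)

Local Notation "g \oc f" := (ccomp g f) (at level 40, left associativity).

Section Preadditive.
Variable C : preadditive.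
Implicit Types W X Y Z T : C.

Lemma ccomp0r X Y Z (g : hom Y Z) : g \oc (0 : hom X Y) = 0.
Proof. by apply: (addIr (g \oc 0)); rewrite -ccompDr !add0r. Qed.

Lemma ccomp0l X Y Z (f : hom X Y) : (0 : hom Y Z) \oc f = 0.
Proof. by apply: (addIr (0 \oc f)); rewrite -ccompDl !add0r. Qed.

Lemma ccompNr X Y Z (g : hom Y Z) (f : hom X Y) : g \oc (- f) = - (g \oc f).
Proof. by apply/eqP; rewrite -addr_eq0 -ccompDr addNr ccomp0r. Qed.

Lemma ccompNl X Y Z (g : hom Y Z) (f : hom X Y) : (- g) \oc f = - (g \oc f).
Proof. by apply/eqP; rewrite -addr_eq0 -ccompDl addNr ccomp0l. Qed.

Lemma ccompBr X Y Z (g : hom Y Z) (f f' : hom X Y) :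
  g \oc (f - f') = g \oc f - g \oc f'.
Proof. by rewrite ccompDr ccompNr. Qed.

Lemma ccompBl X Y Z (g g' : hom Y Z) (f : hom X Y) :
  (g - g') \oc f = g \oc f - g' \oc f.
Proof. by rewrite ccompDl ccompNl. Qed.

Lemma zero_objectP Z : is_zero_object Z <-> idm Z = 0.
Proof.
split=> [h|h X]; first by case: (h Z).
by split=> f; [rewrite -(ccomp1m f)|rewrite -(ccompm1 f)]; rewrite h ?ccomp0l ?ccomp0r.
Qed.

Lemma mono_retraction_iso X Y (m : hom X Y) (s : hom Y X) :
  is_mono m -> m \oc s = idm Y -> is_iso m.
Proof.
move=> hm e; exists s; split=> //; apply: hm.
by rewrite ccompA e ccomp1m ccompm1.
Qed.

Lemma kernel_mono K X Y (k : hom K X) (f : hom X Y) : is_kernel k f -> is_mono k.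
Proof.
move=> [fk hk] T u v e.
have [|w [_ hw]] := hk T (k \oc u); first by rewrite ccompA fk ccomp0l.
by rewrite -(hw u) // -(hw v).
Qed.

(** Schur's lemma. *)
Lemma simple_map_iso X Y (f : hom X Y) : is_abelian C ->
  simple_object X -> simple_object Y -> f <> 0 -> is_iso f.
Proof.
move=> [_ hker _ _ _] [nX sX] [nY sY] f0.
have [K [k hk]] := hker _ _ f.
have [/zero_objectP K0|[g [_ kg]]] := sX _ k (kernel_mono hk); last first.
  by case: f0; case: hk => fk _; rewrite -(ccompm1 f) -kg ccompA fk ccomp0l.
suff fm : is_mono f by have [] := sY _ f fm.
move=> T u v e; apply/eqP; rewrite -subr_eq0; apply/eqP.
have [_ hk2] := hk; have [|w [<- _]] := hk2 _ (u - v).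
  by rewrite ccompBr e subrr.
by rewrite -(ccomp1m w) K0 ccomp0l ccomp0r.
Qed.

Lemma iso_sym X Y : isomorphic X Y -> isomorphic Y X.
Proof. by move=> [f [g [h1 h2]]]; exists g, f. Qed.

Lemma iso_trans X Y Z : isomorphic X Y -> isomorphic Y Z -> isomorphic X Z.
Proof.
move=> [f [f' [h1 h2]]] [g [g' [h3 h4]]]; exists (g \oc f), (f' \oc g'); split.
  by rewrite -ccompA (ccompA g') h3 ccomp1m.
by rewrite -ccompA (ccompA f) h2 ccomp1m.
Qed.

End Preadditive.

(** Objects of a full subcategory are pairs, whereas one object will be viewed
    in several full subcategories at once; hence the following versions of the
    categorical notions, relative to a class [D] of objects of [C]. *)
Section Relative.
Variables (C : preadditive) (D : C -> Prop).
Implicit Types W X Y Z T : C.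

Definition mono_in X Y (f : hom X Y) : Prop :=
  forall T, D T -> forall u v : hom T X, f \oc u = f \oc v -> u = v.

Definition epi_in X Y (f : hom X Y) : Prop :=
  forall T, D T -> forall u v : hom Y T, u \oc f = v \oc f -> u = v.

Definition kernel_in K X Y (k : hom K X) (f : hom X Y) : Prop :=
  f \oc k = 0 /\ forall T, D T -> forall t : hom T X, f \oc t = 0 ->
    exists! u : hom T K, k \oc u = t.

Definition cokernel_in X Y Q (q : hom Y Q) (f : hom X Y) : Prop :=
  q \oc f = 0 /\ forall T, D T -> forall t : hom Y T, t \oc f = 0 ->
    exists! u : hom Q T, u \oc q = t.

Definition abelian_in : Prop :=
  [/\ (exists2 Z, D Z & idm Z = 0) /\
      (forall X Y, D X -> D Y -> exists (P : C) (i1 : hom X P) (i2 : hom Y P)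
         (p1 : hom P X) (p2 : hom P Y), D P /\ is_biproduct i1 i2 p1 p2),
      forall X Y, D X -> D Y -> forall f : hom X Y,
        exists (K : C) (k : hom K X), D K /\ kernel_in k f,
      forall X Y, D X -> D Y -> forall f : hom X Y,
        exists (Q : C) (q : hom Y Q), D Q /\ cokernel_in q f,
      forall X Y, D X -> D Y -> forall f : hom X Y, mono_in f ->
        exists (Z : C) (g : hom Y Z), D Z /\ kernel_in f g
    & forall X Y, D X -> D Y -> forall f : hom X Y, epi_in f ->
        exists (W : C) (g : hom W X), D W /\ cokernel_in f g].

Lemma mono_inE (X Y : full_subcategory D) (f : hom X Y) :
  is_mono f <-> mono_in (f : @hom C (proj1_sig X) (proj1_sig Y)).
Proof.
by split=> h; [move=> T dT; exact: (h (exist D T dT))|move=> [T dT]; exact: h].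
Qed.

Lemma epi_inE (X Y : full_subcategory D) (f : hom X Y) :
  is_epi f <-> epi_in (f : @hom C (proj1_sig X) (proj1_sig Y)).
Proof.
by split=> h; [move=> T dT; exact: (h (exist D T dT))|move=> [T dT]; exact: h].
Qed.

Lemma kernel_inE (K X Y : full_subcategory D) (k : hom K X) (f : hom X Y) :
  is_kernel k f <-> kernel_in (k : @hom C (proj1_sig K) (proj1_sig X))
                      (f : @hom C (proj1_sig X) (proj1_sig Y)).
Proof.
split=> -[h1 h2]; split=> //.
  by move=> T dT; exact: (h2 (exist D T dT)).
by move=> [T dT]; exact: h2.
Qed.

Lemma cokernel_inE (X Y Q : full_subcategory D) (q : hom Y Q) (f : hom X Y) :
  is_cokernel q f <-> cokernel_in (q : @hom C (proj1_sig Y) (proj1_sig Q))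
                      (f : @hom C (proj1_sig X) (proj1_sig Y)).
Proof.
split=> -[h1 h2]; split=> //.
  by move=> T dT; exact: (h2 (exist D T dT)).
by move=> [T dT]; exact: h2.
Qed.

Lemma abelian_inE : is_abelian (full_subcategory D) <-> abelian_in.
Proof.
split=> [[[[Z hZ] hP] hk hc hm he]|[[[Z dZ hZ] hP] hk hc hm he]]; split.
- split.
    exists (proj1_sig Z); first exact: proj2_sig.
    exact/(@zero_objectP (full_subcategory D)).
  move=> X Y dX dY.
  have [[P dP] [i1 [i2 [p1 [p2 h]]]]] := hP (exist D X dX) (exist D Y dY).
  by exists P, i1, i2, p1, p2.
- move=> X Y dX dY f.
  have [[K dK] [k /kernel_inE h]] := hk (exist D X dX) (exist D Y dY) f.
  by exists K, k.
- move=> X Y dX dY f.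
  have [[K dK] [k /cokernel_inE h]] := hc (exist D X dX) (exist D Y dY) f.
  by exists K, k.
- move=> X Y dX dY f /(mono_inE (X := exist D X dX) (Y := exist D Y dY)) fm.
  have [[K dK] [k /kernel_inE h]] := hm (exist D X dX) (exist D Y dY) f fm.
  by exists K, k.
- move=> X Y dX dY f /(epi_inE (X := exist D X dX) (Y := exist D Y dY)) fm.
  have [[K dK] [k /cokernel_inE h]] := he (exist D X dX) (exist D Y dY) f fm.
  by exists K, k.
- split.
    by exists (exist D Z dZ); apply/zero_objectP.
  move=> [X dX] [Y dY].
  have [P [i1 [i2 [p1 [p2 [dP h]]]]]] := hP X Y dX dY.
  by exists (exist D P dP), i1, i2, p1, p2.
- move=> [X dX] [Y dY] f; have [K [k [dK h]]] := hk X Y dX dY f.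
  by exists (exist D K dK), k; apply/kernel_inE.
- move=> [X dX] [Y dY] f; have [K [k [dK h]]] := hc X Y dX dY f.
  by exists (exist D K dK), k; apply/cokernel_inE.
- move=> [X dX] [Y dY] f /mono_inE fm; have [K [k [dK h]]] := hm X Y dX dY f fm.
  by exists (exist D K dK), k; apply/kernel_inE.
- move=> [X dX] [Y dY] f /epi_inE fm; have [K [k [dK h]]] := he X Y dX dY f fm.
  by exists (exist D K dK), k; apply/cokernel_inE.
Qed.

Lemma kernel_in_mono K X Y (k : hom K X) (f : hom X Y) :
  kernel_in k f -> mono_in k.
Proof.
move=> [fk hk] T dT u v e.
have [|w [_ hw]] := hk T dT (k \oc u); first by rewrite ccompA fk ccomp0l.
by rewrite -(hw u) // -(hw v).
Qed.

Lemma cokernel_in_epi X Y Q (q : hom Y Q) (f : hom X Y) :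
  cokernel_in q f -> epi_in q.
Proof.
move=> [qf hq] T dT u v e.
have [|w [_ hw]] := hq T dT (u \oc q); first by rewrite -ccompA qf ccomp0r.
by rewrite -(hw u) // -(hw v).
Qed.

Lemma mono_in0 X Y (f : hom X Y) :
  (forall T, D T -> forall t : hom T X, f \oc t = 0 -> t = 0) -> mono_in f.
Proof.
move=> h T dT u v e; apply/eqP; rewrite -subr_eq0; apply/eqP; apply: h => //.
by rewrite ccompBr e subrr.
Qed.

(** The image factorization.  That [m] is a monomorphism: if [m] kills [t], it
    factors through the cokernel [q'] of [t]; then [q' \oc c] is the cokernel of
    some [h], which [c] also kills, so [q'] has a left inverse and [t] is 0. *)
Lemma abelian_image K X Y Q (k : hom K X) (f : hom X Y) (q : hom Y Q) :
  abelian_in -> D X -> D Y -> D K -> D Q -> kernel_in k f -> cokernel_in q f ->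
  exists (I : C) (c : hom X I) (m : hom I Y),
    [/\ D I, f = m \oc c, kernel_in k c /\ cokernel_in c k
      & kernel_in m q /\ cokernel_in q m].
Proof.
move=> [_ hker hcok hmono hepi] dX dY dK dQ hk hq.
have [I [c [dI hc]]] := hcok _ _ dK dX k.
have [fk hk'] := hk; have [qf hq'] := hq; have [ck hc'] := hc.
have [m [em _]] := hc' Y dY f fk.
have ec := cokernel_in_epi hc.
have mm : mono_in m.
  apply: mono_in0 => T dT t mt.
  have [Q' [q' [dQ' hq2]]] := hcok _ _ dT dI t.
  have [q't hq2'] := hq2.
  have [m' [em' _]] := hq2' _ dY m mt.
  have eqc : epi_in (q' \oc c).
    move=> U dU u v; rewrite !ccompA => /(ec _ dU).
    exact: (cokernel_in_epi hq2).
  have [W [h [dW [qch hh]]]] := hepi _ _ dX dQ' _ eqc.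
  have [|h' [eh' _]] := hk' W dW h.
    by rewrite -em -em' -!ccompA (ccompA q') qch ccomp0r.
  have ch : c \oc h = 0 by rewrite -eh' ccompA ck ccomp0l.
  have [s [es _]] := hh I dI c ch.
  have sq : s \oc q' = idm I.
    by apply: (ec _ dI); rewrite -ccompA es ccomp1m.
  by rewrite -(ccomp1m t) -sq -ccompA q't ccomp0r.
exists I, c, m; split=> //; split.
- split=> // T dT t ct; apply: hk' => //.
  by rewrite -em -ccompA ct ccomp0r.
- by [].
- have [Z [g [dZ [gm hg]]]] := hmono _ _ dI dY m mm.
  have qm : q \oc m = 0.
    by apply: (ec _ dQ); rewrite -ccompA em qf ccomp0l.
  split=> // T dT t qt; apply: hg => //.
  have [|g' [<- _]] := hq' _ dZ g; first by rewrite -em ccompA gm ccomp0l.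
  by rewrite -ccompA qt ccomp0r.
- have qm : q \oc m = 0.
    by apply: (ec _ dQ); rewrite -ccompA em qf ccomp0l.
  split=> // T dT t tm; apply: hq' => //.
  by rewrite -em ccompA tm ccomp0l.
Qed.

Definition splits_in X (e : hom X X) : Prop :=
  exists (K : C) (s : hom K X) (r : hom X K),
    [/\ D K, r \oc s = idm K & s \oc r = e].

(** If every morphism is von Neumann regular and the resulting idempotents
    split, then all kernels and cokernels are direct summands. *)
Lemma regular_abelian :
  (exists2 Z, D Z & idm Z = 0) ->
  (forall X Y, D X -> D Y -> exists (P : C) (i1 : hom X P) (i2 : hom Y P)
     (p1 : hom P X) (p2 : hom P Y), D P /\ is_biproduct i1 i2 p1 p2) ->
  (forall X Y, D X -> D Y -> forall f : hom X Y, exists g : hom Y X,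
     [/\ f \oc g \oc f = f, splits_in (idm X - g \oc f)
       & splits_in (idm Y - f \oc g)]) ->
  abelian_in.
Proof.
move=> hZ hP hreg; split=> // X Y dX dY f.
- have [g [fgf [K [s [r [dK rs sr]]]] _]] := hreg X Y dX dY f.
  exists K, s; split=> //; split.
    rewrite -[s]ccompm1 -rs (ccompA s) sr ccompA ccompBr ccompm1 ccompA fgf.
    by rewrite subrr ccomp0l.
  move=> T dT t ft; exists (r \oc t); split.
    by rewrite ccompA sr ccompBl ccomp1m -ccompA ft ccomp0r subr0.
  by move=> u <-; rewrite ccompA rs ccomp1m.
- have [g [fgf _ [K [s [r [dK rs sr]]]]]] := hreg X Y dX dY f.
  exists K, r; split=> //; split.
    rewrite -[r]ccomp1m -rs -(ccompA r) sr -ccompA ccompBl ccomp1m fgf.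
    by rewrite subrr ccomp0r.
  move=> T dT t tf; exists (t \oc s); split.
    by rewrite -ccompA sr ccompBr ccompm1 ccompA tf ccomp0l subr0.
  by move=> u <-; rewrite -ccompA rs ccompm1.
- move=> fm; have [g [fgf _ [K [s [r [dK rs sr]]]]]] := hreg X Y dX dY f.
  exists K, r; split=> //; split.
    rewrite -[r]ccomp1m -rs -(ccompA r) sr -ccompA ccompBl ccomp1m fgf.
    by rewrite subrr ccomp0r.
  move=> T dT t rt; exists (g \oc t).
  have ft : f \oc (g \oc t) = t.
    apply/eqP; rewrite eq_sym -subr_eq0 ccompA -[X in X - _]ccomp1m -ccompBl -sr.
    by rewrite -ccompA rt ccomp0r.
  by split=> // u eu; apply: (fm T dT); rewrite eu.
- move=> fe; have [g [fgf [K [s [r [dK rs sr]]]] _]] := hreg X Y dX dY f.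
  exists K, s; split=> //; split.
    rewrite -[s]ccompm1 -rs (ccompA s) sr ccompA ccompBr ccompm1 ccompA fgf.
    by rewrite subrr ccomp0l.
  move=> T dT t ts; exists (t \oc g).
  have tf : t \oc g \oc f = t.
    apply/eqP; rewrite eq_sym -subr_eq0 -ccompA -[X in X - _]ccompm1 -ccompBr -sr.
    by rewrite ccompA ts ccomp0l.
  by split=> // u eu; apply: (fe T dT); rewrite eu.
Qed.

End Relative.

(** * Distinguished abelian subcategories containing the simple modules *)


(** The exactness of a triangle: the lifting properties of a kernel and of a
    cokernel, without uniqueness. *)
Definition weakly_exact (C : preadditive) (X Y Z : C) (f : hom X Y) (g : hom Y Z) :=
  (forall T (t : hom T Y), g \oc t = 0 -> exists w : hom T X, f \oc w = t) /\
  (forall T (t : hom Y T), t \oc f = 0 -> exists w : hom Z T, w \oc g = t).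

Lemma weakly_exact_iso (C : preadditive) (X Y Z X' Y' Z' : C)
    (f : hom X Y) (g : hom Y Z) (f' : hom X' Y') (g' : hom Y' Z')
    (a : hom X X') (b : hom Y Y') (c : hom Z Z') :
  is_iso a -> is_iso b -> is_iso c ->
  b \oc f = f' \oc a -> c \oc g = g' \oc b ->
  weakly_exact f' g' -> weakly_exact f g.
Proof.
move=> [a' [a'a aa']] [b' [b'b bb']] [c' [c'c cc']] ef eg [wk wc].
split=> T t ht.
  have [|w hw] := wk T (b \oc t).
    by rewrite ccompA -eg -ccompA ht ccomp0r.
  exists (a' \oc w).
  rewrite -[LHS]ccomp1m -b'b -ccompA (ccompA b) ef -(ccompA f') (ccompA a) aa'.
  by rewrite ccomp1m hw ccompA b'b ccomp1m.
have [|w hw] := wc T (t \oc b').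
  rewrite -[LHS]ccompm1 -aa' ccompA -(ccompA _ f') -ef.
  by rewrite (ccompA (t \oc b')) -(ccompA t) b'b ccompm1 ht ccomp0l.
by exists (w \oc c); rewrite -ccompA eg ccompA hw -ccompA b'b ccompm1.
Qed.

Section Zorn.
Variable T : Type.
Implicit Types (D E : T -> Prop) (F P : (T -> Prop) -> Prop).

Definition subclass D E := forall x, D x -> E x.
Definition union F : T -> Prop := fun x => exists2 D, F D & D x.
Definition chain F := forall D E, F D -> F E -> subclass D E \/ subclass E D.

Lemma subclass_anti D E : subclass D E -> subclass E D -> D = E.
Proof. by move=> h1 h2; apply/funext => x; apply/propext; split; [exact: h1|exact: h2]. Qed.

Section Tower.
Variable s : (T -> Prop) -> T -> Prop.
Hypothesis sI : forall D, subclass D (s D).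

(** The transfinite iterates of [s], starting from the empty union. *)
Inductive tower : (T -> Prop) -> Prop :=
| tower_succ D : tower D -> tower (s D)
| tower_union F : (forall D, F D -> tower D) -> tower (union F).

Definition extreme D :=
  forall E, tower E -> subclass E D -> ~ subclass D E -> subclass (s E) D.

(** With all members of the tower extreme, this makes the tower a chain. *)
Lemma extreme_dichotomy D E : extreme D -> tower E ->
  subclass E D \/ subclass (s D) E.
Proof.
move=> xD; elim=> {E} [E tE [ED|DE]|F tF IH].
- have [DE|nDE] := pselect (subclass D E); last by left; exact: xD.
  by right; rewrite (subclass_anti ED DE).
- by right=> x /DE; exact: sI.
- have [h|/existsNP[E /not_implyP[FE nED]]] := pselect (forall E, F E -> subclass E D).
    by left=> x [E FE Ex]; exact: h Ex.
  by right=> x hx; exists E => //; case: (IH E FE) => [/nED//|]; apply.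
Qed.

Lemma tower_extreme D : tower D -> extreme D.
Proof.
elim=> {D} [D tD xD E tE ED nDE|F tF IH E tE EF nFE].
- have [ED'|//] := extreme_dichotomy xD tE.
  have [DE'|nDE'] := pselect (subclass D E); first by rewrite (subclass_anti ED' DE').
  by move=> x hx; apply/sI/(xD E tE ED' nDE').
- have [D FD nDE] : exists2 D, F D & ~ subclass D E.
    apply: contrapT => h; apply: nFE => x [D FD Dx]; apply: contrapT => nEx.
    by apply: h; exists D => // /(_ x Dx).
  have [ED|DE] := extreme_dichotomy (IH D FD) tE.
    by move=> x hx; exists D => //; exact: (IH D FD E tE ED nDE).
  by case: nDE => x /sI /DE.
Qed.

Lemma tower_chain : chain tower.
Proof.
move=> D E tD tE; have [|h] := extreme_dichotomy (tower_extreme tE) tD; first by left.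
by right=> x /sI /h.
Qed.

End Tower.

(** Zorn's lemma for inclusion, with [T] in an arbitrary universe because [T]
    will be the large type of modules.  Without a maximal element, some [s]
    properly enlarges every member of [P]; the union of the tower of [s] is a
    member of [P], and [s] maps it into itself. *)
Lemma zorn_union P :
  (forall F, (forall D, F D -> P D) -> chain F -> P (union F)) ->
  exists D, P D /\ forall E, P E -> subclass D E -> subclass E D.
Proof.
move=> hP; apply: contrapT => nomax.
have /choice[s hs] : forall D, exists E, subclass D E /\
    (P D -> P E /\ ~ subclass E D).
  move=> D; have [PD|nPD] := pselect (P D); last by exists D; split=> [x|].
  apply: contrapT => h; apply: nomax; exists D; split=> // E PE DE.
  by apply: contrapT => nED; apply: h; exists E.
have sI D : subclass D (s D) by have [] := hs D.
have tP D : tower s D -> P D.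
  elim=> {D} [D tD PD|F tF PF]; first by have [_ /(_ PD)[]] := hs D.
  by apply: hP => // D E /tF tD /tF tE; exact: tower_chain tD tE.
have tU : tower s (union (tower s)) by exact: tower_union.
have [_ /(_ (tP _ tU))[_]] := hs (union (tower s)); apply=> x hx.
by exists (s (union (tower s))) => //; exact: tower_succ.
Qed.

End Zorn.

Section Distinguished.
Variables (k : fieldType) (A : falgType k).
Hypothesis hself : selfinjective A.
Let C := stmodcat A.
Implicit Types U V W X Y Z : fgmodule A.

(** One half lifts a map from a projective module along [p]; the other extends
    a map to an injective module along [i], and here selfinjectivity enters. *)
Lemma ses_weakly_exact U V W (i : mhom U V) (p : mhom V W) : module_ses i p ->
  @weakly_exact C U V W (stable i) (stable p).
Proof.
move=> [ii kp sp]; split=> T t.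
  rewrite -(stable_repr t) [_ \oc _]st_compE => /stable_eq0[P [u [v [hP e]]]].
  have [v' hv'] := hP _ _ p v sp.
  pose d : mhom T V := (repr t : mhom T V) - ((v' \o u : {linear T -> V}) : mhom T V).
  have [|w hw] := @factor_inj _ _ _ _ i d ii.
    by move=> x; apply/kp; rewrite linearB /= hv' -e subrr.
  exists (stable (w : mhom T U)); rewrite [LHS]st_compE; apply/stable_eq.
  exists P, u, (\- v' : {linear P -> V}); split=> // x /=.
  by rewrite hw /d /= addrC addrA addNr add0r.
rewrite -(stable_repr t) [_ \oc _]st_compE => /stable_eq0 ft.
have [f' ff' hf'] := factors_extend hself ii ft.
pose d : mhom V T := (repr t : mhom V T) - (f' : mhom V T).
have [|w hw] := @factor_surj _ _ _ _ p d sp.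
  by move=> y /kp[x <-]; rewrite /d /= hf' subrr.
exists (stable (w : mhom W T)); rewrite [LHS]st_compE; apply/stable_eq.
have [P [u [v [hP e]]]] := ff'.
exists P, u, (\- v : {linear P -> T}); split=> // x /=.
by rewrite hw /d /= addrC addrA addNr add0r e.
Qed.

Lemma triangle_weakly_exact X Y Z (f : @hom C X Y) (g : @hom C Y Z)
    (h : @hom C Z (Sigma X)) :
  exact_triangle f g h -> weakly_exact f g.
Proof.
move=> [U [V [W [f' [g' [h' [a [b [c [s [[st ia ib ic _] [ef eg _]]]]]]]]]]]].
apply: (weakly_exact_iso ia ib ic ef eg).
have [i [p [v [d [[-> -> _] [hs _ _]]]]]] := st.
exact: ses_weakly_exact.
Qed.

Lemma nonzero_from_simple X : idm (X : C) <> 0 ->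
  exists (T : fgmodule A) (f : @hom C T X), simple_module T /\ f <> 0.
Proof.
move=> nX; apply: contrapT => hT; apply: nX.
apply/(stable_eq0 (mhom_id X)).
apply: (stably_zero_of_simples hself) => T f sT.
apply/(stable_eq0 (f : mhom T X)); apply: contrapT => f0.
by apply: hT; exists T, (stable (f : mhom T X)).
Qed.

Definition contains_simples (D : C -> Prop) :=
  forall S : fgmodule A, simple_module S -> D S.

(** Monomorphisms can be tested on simple modules, so being one does not depend
    on the subcategory. *)
Lemma mono_in_simples (D : C -> Prop) X Y (f : @hom C X Y) :
  abelian_in D -> D X -> D Y ->
  (forall (T : fgmodule A), simple_module T -> forall t : @hom C T X,
     f \oc t = 0 -> t = 0) -> contains_simples D ->
  mono_in D f.
Proof.
move=> [_ hker _ _ _] dX dY hf hD.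
have [K [j [dK hj]]] := hker _ _ dX dY f.
have K0 : idm K = 0.
  apply: contrapT => /nonzero_from_simple[T [t [sT]]]; apply.
  have jt : j \oc t = 0.
    by apply: (hf T sT); have [fj _] := hj; rewrite ccompA fj ccomp0l.
  by apply: (kernel_in_mono hj (hD T sT)); rewrite jt ccomp0r.
apply: mono_in0 => T dT t ft; have [_ hj'] := hj.
have [w [<- _]] := hj' T dT t ft.
by rewrite -(ccomp1m w) K0 ccomp0l ccomp0r.
Qed.

Definition triangulated_in (D : C -> Prop) :=
  forall X Y Z, D X -> D Y -> D Z -> forall (f : @hom C X Y) (g : @hom C Y Z),
  kernel_in D f g -> cokernel_in D g f ->
  exists h : @hom C Z (Sigma X), exact_triangle f g h.

Lemma distinguished_inE (D : C -> Prop) :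
  distinguished_abelian D <-> abelian_in D /\ triangulated_in D.
Proof.
split=> -[/abelian_inE ab h]; split=> //.
  move=> X Y Z dX dY dZ f g hk hc.
  apply: (h (exist D X dX) (exist D Y dY) (exist D Z dZ) f g).
  by split; [apply/kernel_inE|apply/cokernel_inE].
move=> [X dX] [Y dY] [Z dZ] f g [/kernel_inE hk /cokernel_inE hc].
exact: h.
Qed.

Section Inclusion.
Variables D D' : C -> Prop.
Hypothesis sDD' : forall X, D X -> D' X.
Hypotheses (abD : abelian_in D) (trD : triangulated_in D).
Hypotheses (abD' : abelian_in D') (hD : contains_simples D).

Lemma mono_in_incl X Y (f : @hom C X Y) : D X -> D Y -> mono_in D f -> mono_in D' f.
Proof.
move=> dX dY fm; apply: mono_in_simples => //; try exact: sDD'.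
- by move=> T sT t ft; apply: (fm T (hD sT)); rewrite ft ccomp0r.
- by move=> S sS; apply/sDD'/hD.
Qed.

(** A short exact sequence of [D] lies in a triangle, so its maps are a weak
    kernel and a weak cokernel of each other against all objects; the first is
    still a monomorphism in [D'], and the second is up to isomorphism the
    cokernel that the first has in [D']. *)
Lemma short_exact_incl X Y Z (f : @hom C X Y) (g : @hom C Y Z) :
  D X -> D Y -> D Z -> kernel_in D f g -> cokernel_in D g f ->
  kernel_in D' f g /\ cokernel_in D' g f.
Proof.
move=> dX dY dZ hk hc.
have [h /triangle_weakly_exact[wk wc]] := trD dX dY dZ hk hc.
have fm := mono_in_incl dX dY (kernel_in_mono hk).
have [gf _] := hk; have ge := cokernel_in_epi hc.
split; split=> // T dT t ht.
  have [w hw] := wk T t ht; exists w; split=> // u hu.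
  by apply: (fm T dT); rewrite hu.
have [w hw] := wc T t ht; exists w; split=> // u hu.
have [_ _ hcok _ _] := abD'.
have [Q [c [dQ hc']]] := hcok _ _ (sDD' dX) (sDD' dY) f.
have ec := cokernel_in_epi hc'; have [cf hc2] := hc'.
have [r [er _]] := hc2 Z (sDD' dZ) g gf.
have [s es] := wc Q c cf.
have rs : r \oc s = idm (Z : C) by apply: (ge _ dZ); rewrite -ccompA es er ccomp1m.
have e : w \oc r = u \oc r.
  by apply: (ec T dT); rewrite -!ccompA er hw hu.
by rewrite -(ccompm1 w) -rs ccompA e -ccompA rs ccompm1.
Qed.

(** Both halves of the image factorization in [D] are short exact sequences. *)
Lemma image_incl X Y K Q (j : @hom C K X) (f : @hom C X Y) (q : @hom C Y Q) :
  D X -> D Y -> D K -> D Q -> kernel_in D j f -> cokernel_in D q f ->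
  kernel_in D' j f /\ cokernel_in D' q f.
Proof.
move=> dX dY dK dQ hj hq.
have [I [c [m [dI -> [h1 h2] [h3 h4]]]]] := abelian_image abD dX dY dK dQ hj hq.
have [[cj hj'] hc'] := short_exact_incl dK dX dI h1 h2.
have [hm' [qm hq']] := short_exact_incl dI dY dQ h3 h4.
have mm := kernel_in_mono hm'; have ec := cokernel_in_epi hc'.
split; split.
- by rewrite -ccompA cj ccomp0r.
- move=> T dT t mct; apply: hj' => //; apply: (mm T dT).
  by rewrite ccompA mct ccomp0r.
- by rewrite ccompA qm ccomp0l.
- move=> T dT t tmc; apply: hq' => //; apply: (ec T dT).
  by rewrite -ccompA tmc ccomp0l.
Qed.

Lemma kernel_in_incl X Y K (j : @hom C K X) (f : @hom C X Y) :
  D X -> D Y -> D K -> kernel_in D j f -> kernel_in D' j f.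
Proof.
move=> dX dY dK hj; have [_ _ hcok _ _] := abD.
by have [Q [q [dQ hq]]] := hcok _ _ dX dY f; have [] := image_incl dX dY dK dQ hj hq.
Qed.

Lemma cokernel_in_incl X Y Q (f : @hom C X Y) (q : @hom C Y Q) :
  D X -> D Y -> D Q -> cokernel_in D q f -> cokernel_in D' q f.
Proof.
move=> dX dY dQ hq; have [_ hker _ _ _] := abD.
by have [K [j [dK hj]]] := hker _ _ dX dY f; have [] := image_incl dX dY dK dQ hj hq.
Qed.

End Inclusion.

Definition distinguished_over_simples (D : C -> Prop) :=
  [/\ abelian_in D, triangulated_in D & contains_simples D].

(** Any finite diagram in the union lies in one member of the chain, and by
    exactness of the inclusions its kernels and cokernels may be taken there. *)
Lemma distinguished_over_simples_union (F : (C -> Prop) -> Prop) : (exists D, F D) ->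
  (forall D, F D -> distinguished_over_simples D) -> chain F ->
  distinguished_over_simples (union F).
Proof.
move=> [D0 FD0] hF ch; set U := union F.
have up D : F D -> forall X, D X -> U X by move=> FD X DX; exists D.
have join D1 D2 : F D1 -> F D2 -> exists2 D, F D & subclass D1 D /\ subclass D2 D.
  by move=> F1 F2; have [h|h] := ch _ _ F1 F2; [exists D2|exists D1] => //; split=> // x.
have two X Y : U X -> U Y -> exists2 D, F D & D X /\ D Y.
  move=> [D1 F1 h1] [D2 F2 h2]; have [D FD [s1 s2]] := join _ _ F1 F2.
  by exists D => //; split; [exact: s1|exact: s2].
have kerU D (K X Y : C) (j : hom K X) (f : hom X Y) : F D -> D K -> D X -> D Y ->
    kernel_in D j f -> kernel_in U j f.
  move=> FD dK dX dY hj; split=> [|T [D' FD' dT]]; first by case: hj.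
  have [a t s] := hF _ FD; have [a' _ _] := hF _ FD'.
  have [h|h] := ch _ _ FD FD'.
    by have [_] := kernel_in_incl h a t a' s dX dY dK hj; apply.
  by case: hj => _; apply; exact: h.
have cokU D (X Y Q : C) (f : hom X Y) (q : hom Y Q) : F D -> D X -> D Y -> D Q ->
    cokernel_in D q f -> cokernel_in U q f.
  move=> FD dX dY dQ hq; split=> [|T [D' FD' dT]]; first by case: hq.
  have [a t s] := hF _ FD; have [a' _ _] := hF _ FD'.
  have [h|h] := ch _ _ FD FD'.
    by have [_] := cokernel_in_incl h a t a' s dX dY dQ hq; apply.
  by case: hq => _; apply; exact: h.
split.
- split.
  + split.
      by have [[[[Z dZ hZ] _] _ _ _ _] _ _] := hF _ FD0; exists Z => //; exists D0.
    move=> X Y uX uY; have [D FD [dX dY]] := two _ _ uX uY.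
    have [[[_ hP] _ _ _ _] _ _] := hF _ FD.
    have [P [i1 [i2 [p1 [p2 [dP h]]]]]] := hP _ _ dX dY.
    by exists P, i1, i2, p1, p2; split=> //; exact: up dP.
  + move=> X Y uX uY f; have [D FD [dX dY]] := two _ _ uX uY.
    have [[_ hk _ _ _] _ _] := hF _ FD; have [K [j [dK hj]]] := hk _ _ dX dY f.
    by exists K, j; split; [exact: up dK|exact: kerU hj].
  + move=> X Y uX uY f; have [D FD [dX dY]] := two _ _ uX uY.
    have [[_ _ hc _ _] _ _] := hF _ FD; have [Q [q [dQ hq]]] := hc _ _ dX dY f.
    by exists Q, q; split; [exact: up dQ|exact: cokU hq].
  + move=> X Y uX uY f fm; have [D FD [dX dY]] := two _ _ uX uY.
    have [[_ _ _ hm _] _ _] := hF _ FD.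
    have [|Z [g [dZ hg]]] := hm _ _ dX dY f; first by move=> T dT; apply: fm; exact: up dT.
    by exists Z, g; split; [exact: up dZ|exact: kerU hg].
  + move=> X Y uX uY f fe; have [D FD [dX dY]] := two _ _ uX uY.
    have [[_ _ _ _ he] _ _] := hF _ FD.
    have [|Z [g [dZ hg]]] := he _ _ dX dY f; first by move=> T dT; apply: fe; exact: up dT.
    by exists Z, g; split; [exact: up dZ|exact: cokU hg].
- move=> X Y Z uX uY uZ f g hk hc.
  have [D1 FD1 [dX dY]] := two _ _ uX uY; have [D2 FD2 dZ] := uZ.
  have [D FD [s1 s2]] := join _ _ FD1 FD2.
  have [_ tr _] := hF _ FD.
  apply: tr; [exact: s1|exact: s1|exact: s2|case: hk => h1 h2|case: hc => h1 h2].
    by split=> // T dT; apply: h2; exact: up dT.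
  by split=> // T dT; apply: h2; exact: up dT.
- by move=> S sS; exists D0 => //; have [_ _ h] := hF _ FD0; exact: h.
Qed.

(** Zorn's lemma also demands a bound for the empty chain; adjoining the
    empty class provides it. *)
Lemma exists_maximal_over_simples D0 : distinguished_over_simples D0 ->
  exists D, distinguished_over_simples D /\
    forall D', distinguished_over_simples D' -> subclass D D' -> subclass D' D.
Proof.
move=> g0; pose P D := (forall X, ~ D X) \/ distinguished_over_simples D.
have [F FP ch|D [D_or Dmax]] := @zorn_union (ob C) P.
  have [[D FD gD]|nF] := pselect (exists2 D, F D & distinguished_over_simples D); last first.
    left=> X [D FD DX]; case: (FP _ FD) => [nD|gD]; first exact: nD DX.
    by apply: nF; exists D.
  right; have -> : union F = union (fun D => F D /\ distinguished_over_simples D).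
    apply: subclass_anti => X [E FE EX]; exists E => //; last by case: FE.
    by case: (FP _ FE) => [/(_ X)|].
  apply: distinguished_over_simples_union; first by exists D.
    by move=> E [].
  by move=> E E' [FE _] [FE' _]; exact: ch.
have gD : distinguished_over_simples D.
  case: D_or => [nD|//].
  have h := Dmax D0 (or_intror g0) (fun X DX => False_ind _ (nD X DX)).
  have [[[[Z dZ _] _] _ _ _ _] _ _] := g0.
  by case: (nD Z); exact: h.
by exists D; split=> // D' gD'; apply: Dmax; right.
Qed.

End Distinguished.

(** * Semisimple modules *)

Section Semisimple.
Variables (k : fieldType) (A : falgType k).
Implicit Types (U V W X Y Z : fgmodule A).

(** A projection onto [N] stands for a complement of [N]. *)
Definition semisimple (V : lmodType A) : Prop :=
  forall N : {pred V}, GRing.submod_closed N ->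
    exists e : {linear V -> V}, (forall x, e x \in N) /\
      forall x, x \in N -> e x = x.

Lemma simple_semisimple (V : lmodType A) : simple_module V -> semisimple V.
Proof.
move=> [_ sV] N hN; have [N0 _] := hN; have [h|h] := sV N hN.
  by exists \0; split=> // x /h ->.
by exists idfun.
Qed.

Lemma injective_semisimple (U V : lmodType A) (i : {linear U -> V}) :
  injective i -> semisimple V -> semisimple U.
Proof.
move=> ii sV N [N0 Nl].
pose M : {pred V} := [pred y | `[< exists2 x, i x = y & x \in N >]].
have MP y : reflect (exists2 x, i x = y & x \in N) (y \in M) by exact: asboolP.
have hM : GRing.submod_closed M.
  split; first by apply/MP; exists 0; rewrite ?linear0.
  move=> a _ _ /MP[x <- hx] /MP[y <- hy].
  by apply/MP; exists (a *: x + y); [rewrite linearP|apply: Nl].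
have [e [eM eK]] := sV M hM.
have [w hw] : exists w : {linear U -> U}, forall x, i (w x) = e (i x).
  apply: (factor_inj (q := e \o i : {linear U -> V})) => // x.
  by have /MP[y hy _] := eM (i x); exists y.
exists w; split=> x.
  by have /MP[y] := eM (i x); rewrite -hw => /ii ->.
by move=> hx; apply: ii; rewrite hw eK //; apply/MP; exists x.
Qed.

(** The projection onto a submodule [N] of [U * V]: the part of [N] above [V]
    is lifted along [x - e1 x], which depends only on the second component. *)
Lemma prod_semisimple (U V : lmodType A) : semisimple U -> semisimple V ->
  semisimple (U * V)%type.
Proof.
move=> sU sV N [N0 Nl].
have hN1 : GRing.submod_closed [pred x : U | (x, 0) \in N].
  split=> [|a x y]; rewrite !inE // => hx hy.
  by have := Nl a _ _ hx hy; congr (_ \in N); congr pair; rewrite /= scaler0 addr0.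
pose N2 : {pred V} := [pred y | `[< exists x : U, (x, y) \in N >]].
have N2P y : reflect (exists x : U, (x, y) \in N) (y \in N2) by exact: asboolP.
have hN2 : GRing.submod_closed N2.
  split; first by apply/N2P; exists 0.
  move=> a y y' /N2P[x hx] /N2P[x' hx']; apply/N2P; exists (a *: x + x').
  exact: (Nl a _ _ hx hx').
have [e1 [e1N e1K]] := sU _ hN1; have [e2 [e2N e2K]] := sV _ hN2.
have /choice[t ht] : forall y, exists x, (x, e2 y) \in N by move=> y; exact/N2P.
pose s y := t y - e1 (t y).
have sE x y : (x, e2 y) \in N -> x - e1 x = s y.
  move=> hx; have hd : x - t y \in [pred x : U | (x, 0) \in N].
    rewrite inE; have := Nl (-1) _ _ (ht y) hx; congr (_ \in N).
    by congr pair; rewrite /= ?scaleN1r ?addNr // addrC.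
  have := e1K _ hd; rewrite linearB => h.
  by apply/eqP; rewrite -subr_eq0 /s opprD addrACA -opprD h subrr.
have sl : linear s.
  move=> a y y'; rewrite -(sE (a *: t y + t y')).
    by rewrite /s linearP scalerBr opprD addrACA.
  by have := Nl a _ _ (ht y) (ht y'); congr (_ \in N); congr pair; rewrite linearP.
have sN y : (s y, e2 y) \in N.
  have := Nl (-1) _ _ (e1N (t y)) (ht y); congr (_ \in N); congr pair.
    by rewrite /= scaleN1r addrC.
  by rewrite /= scaler0 add0r.
have lE : linear (fun z : (U * V)%type => (s z.2 + e1 (z.1 - s z.2), e2 z.2)).
  move=> a [x y] [x' y']; congr pair => /=; last by rewrite linearP.
  rewrite sl [in RHS]scalerDr [RHS]addrACA; congr (_ + _).
  by rewrite -linearP scalerBr; congr (e1 _); rewrite opprD addrACA.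
exists (mk_linear lE); split=> [[x y]|[x y] hxy] /=.
  have := Nl 1 _ _ (e1N (x - s y)) (sN y); congr (_ \in N).
  by congr pair; rewrite /= scale1r ?add0r // addrC.
have ey : e2 y = y by apply: e2K; apply/N2P; exists x.
congr pair => //; rewrite -(sE x) ?ey // linearB linearB /=.
by rewrite (e1K (e1 x)) // subrr subr0 subrK.
Qed.

End Semisimple.

Lemma stable_comp (R : nzRingType) (U V W : fgmodule R) (g : mhom V W)
    (f : mhom U V) :
  @ccomp (stmodcat R) U V W (stable g) (stable f) = stable (mhom_comp g f).
Proof. exact: st_compE. Qed.

Section Product.
Variable R : nzRingType.

Lemma free_fg n : finitely_generated ('rV[R]_n : lmodType R).
Proof.
exists n, (delta_mx 0) => u; exists (fun i => u 0 i).
exact: row_sum_delta.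
Qed.

Lemma prod_fg (U V : lmodType R) : finitely_generated U ->
  finitely_generated V -> finitely_generated (U * V)%type.
Proof.
move=> /fg_free_cover[m [p sp]] /fg_free_cover[n [q sq]].
have l : linear (fun u : 'rV[R]_(m + n) => (p (lsubmx u), q (rsubmx u)) : (U * V)%type).
  by move=> a u v; congr pair; rewrite !linearP.
apply: (image_fg (p := mk_linear l)) (free_fg _) => -[x y].
have [u hu] := sp x; have [v hv] := sq y.
by exists (row_mx u v); rewrite /= row_mxKl row_mxKr hu hv.
Qed.

Definition fgprod (U V : fgmodule R) : fgmodule R :=
  FGModule (prod_fg (fgmod_fg U) (fgmod_fg V)).

Variables U V : fgmodule R.

Lemma prod_inl_linear : linear (fun x : U => (x, 0) : (U * V)%type).
Proof. by move=> a x y; congr pair; rewrite /= scaler0 addr0. Qed.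
Lemma prod_inr_linear : linear (fun y : V => (0, y) : (U * V)%type).
Proof. by move=> a x y; congr pair; rewrite /= scaler0 addr0. Qed.
Lemma prod_fst_linear : linear (fun z : (U * V)%type => z.1).
Proof. by []. Qed.
Lemma prod_snd_linear : linear (fun z : (U * V)%type => z.2).
Proof. by []. Qed.

Definition prod_inl : mhom U (fgprod U V) := mk_linear prod_inl_linear.
Definition prod_inr : mhom V (fgprod U V) := mk_linear prod_inr_linear.
Definition prod_fst : mhom (fgprod U V) U := mk_linear prod_fst_linear.
Definition prod_snd : mhom (fgprod U V) V := mk_linear prod_snd_linear.

Lemma stable_biproduct : @is_biproduct (stmodcat R) U V (fgprod U V)
  (stable prod_inl) (stable prod_inr) (stable prod_fst) (stable prod_snd).
Proof.
split; rewrite ?[_ \oc _]st_compE.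
- by congr stable; apply: linear_ext.
- by congr stable; apply: linear_ext.
- by rewrite -(stable0 V U); congr stable; apply: linear_ext.
- by rewrite -(stable0 U V); congr stable; apply: linear_ext.
- rewrite -stableD; congr stable.
  by apply: linear_ext => -[x y]; congr pair; rewrite /= ?addr0 ?add0r.
Qed.

End Product.

Section SemisimpleSubcategory.
Variables (k : fieldType) (A : falgType k).
Implicit Types (U V W X Y Z : fgmodule A).
Let C := stmodcat A.
Let D0 : C -> Prop := fun X => semisimple X.

(** Project onto the image of [f], then invert [f] on a complement of its
    kernel. *)
Lemma semisimple_regular X Y (f : {linear X -> Y}) :
  semisimple X -> semisimple Y ->
  exists g : {linear Y -> X}, forall x, f (g (f x)) = f x.
Proof.
move=> sX sY.
have [e [eN eK]] := sX _ (kernel_pred_closed f).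
have [p [pN pK]] := sY _ (image_pred_closed f).
pose I := submodule (image_pred_closed f).
have [f' hf'] : exists f' : {linear X -> I}, forall x, submod_incl _ (f' x) = f x.
  apply: factor_inj; first exact: submod_incl_inj.
  by move=> x; apply: submod_inclK; apply/image_predP; exists x.
have [p' hp'] : exists p' : {linear Y -> I}, forall y, submod_incl _ (p' y) = p y.
  apply: factor_inj; first exact: submod_incl_inj.
  by move=> y; apply: submod_inclK.
have l1 : linear (fun x => x - e x).
  by move=> a x y; rewrite linearP scalerBr opprD addrACA.
have [h hh] : exists h : {linear I -> X}, forall x, h (f' x) = x - e x.
  apply: (factor_surj (q := mk_linear l1)) => [z|x hx].
    have /image_predP[x hx] := submod_inclP z.
    by exists x; apply: submod_incl_inj; rewrite hf'.
  apply/eqP; rewrite subr_eq0 eq_sym; apply/eqP/eK/kernel_predP.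
  by rewrite -hf' hx linear0.
exists (h \o p' : {linear Y -> X}) => x /=.
have -> : p' (f x) = f' x.
  apply: submod_incl_inj; rewrite hp' hf'; apply: pK; apply/image_predP.
  by exists x.
by rewrite hh linearB; have /kernel_predP -> := eN x; rewrite subr0.
Qed.

Lemma idempotent_splits X (e : mhom X X) : D0 X ->
  mhom_comp e e = e -> @splits_in C D0 X (stable e).
Proof.
move=> sX ee; pose hI := image_pred_closed e; pose I := fgsubmodule hI.
have [r hr] : exists r : {linear X -> I}, forall x, submod_incl hI (r x) = e x.
  apply: factor_inj; first exact: submod_incl_inj.
  by move=> x; apply: submod_inclK; apply/image_predP; exists x.
exists I, (stable (submod_incl hI : mhom I X)), (stable (r : mhom X I)); split.
- exact: injective_semisimple (@submod_incl_inj _ _ _ hI) sX.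
- rewrite [LHS]st_compE; congr stable; apply: linear_ext => y.
  apply: (@submod_incl_inj _ _ _ hI); rewrite [LHS]hr.
  have /image_predP[x <-] := submod_inclP y.
  exact: (congr1 (fun f : mhom X X => f x) ee).
- by rewrite [LHS]st_compE; congr stable; apply: linear_ext => x; exact: hr.
Qed.

Lemma semisimple_abelian : abelian_in D0.
Proof.
apply: regular_abelian.
- exists (FGModule (free_fg A 0)).
    by move=> N [N0 _]; exists idfun; split=> // x; rewrite (thinmx0 x).
  rewrite -stable0; congr stable; apply: linear_ext => x.
  by rewrite [LHS]thinmx0.
- move=> X Y sX sY; exists (fgprod X Y).
  exists (stable (prod_inl X Y)), (stable (prod_inr X Y)).
  exists (stable (prod_fst X Y)), (stable (prod_snd X Y)).
  by split; [exact: prod_semisimple|exact: stable_biproduct].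
move=> X Y sX sY f.
have [g hg] := semisimple_regular (repr f : mhom X Y) sX sY.
pose f0 : mhom X Y := repr f; pose g0 : mhom Y X := g.
have fgf : mhom_comp (mhom_comp f0 g0) f0 = f0 by apply: linear_ext => x; exact: hg.
have ef : f = stable f0 by rewrite stable_repr.
exists (stable g0); rewrite ef; split.
- by rewrite (stable_comp f0 g0) stable_comp fgf.
- rewrite stable_comp -stableN -stableD; apply: idempotent_splits => //.
  apply: linear_ext => x /=.
  have -> : g0 (f0 (x - g0 (f0 x))) = 0; last by rewrite subr0.
  by rewrite [f0 (_ - _)]linearB hg subrr linear0.
- rewrite stable_comp -stableN -stableD; apply: idempotent_splits => //.
  apply: linear_ext => x /=.
  have -> : f0 (g0 (x - f0 (g0 x))) = 0; last by rewrite subr0.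
  by rewrite [g0 (_ - _)]linearB linearB hg subrr.
Qed.

(** A short exact sequence of semisimple modules splits, so it is isomorphic to
    the triangle of the split sequence on [X] and [Z], with zero third map. *)
Lemma split_triangle X Y Z (f : @hom C X Y) (g : @hom C Y Z)
    (r : @hom C Y X) (s : @hom C Z Y) :
  r \oc f = idm (X : C) -> g \oc s = idm (Z : C) -> g \oc f = 0 ->
  f \oc r + s \oc g = idm (Y : C) ->
  exact_triangle f g (0 : @hom C Z (Sigma X)).
Proof.
move=> rf gs gf e.
have rs : r \oc s = 0.
  have : r \oc (f \oc r + s \oc g) \oc s = r \oc s by rewrite e ccompm1.
  rewrite ccompDr ccompDl !ccompA rf ccomp1m -(ccompA (r \oc s)) gs ccompm1.
  by move=> /eqP; rewrite -subr_eq0 addrK => /eqP.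
have [p1i1 p2i2 p1i2 p2i1 eP] := stable_biproduct X Z.
(* A genuine injective envelope makes [X -> envelope X -> Sigma X] vanish. *)
have [_ _ [_ kE _]] := chosen_cosyzygyP X.
pose v : mhom (fgprod X Z) (envelope X) := mhom_comp (env_inj X) (prod_fst X Z).
exists X, (fgprod X Z), Z, (stable (prod_inl X Z)), (stable (prod_snd X Z)), 0.
exists (idm (X : C)).
exists (@ccomp C _ _ _ (stable (prod_inl X Z)) r +
        @ccomp C _ _ _ (stable (prod_inr X Z)) g).
exists (idm (Z : C)), (idm (Sigma X : C)); split; split.
- exists (prod_inl X Z), (prod_snd X Z), v, (0 : mhom Z (Sigma X)).
  split; first by rewrite stable0.
  split=> //; last by move=> [x z]; rewrite /v /=; apply/esym/kE; exists x.
  split=> [x y []//|[x z]|z]; last by exists (0, z).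
  split=> [/= ->|[y [_ <-]]//]; by exists x.
- by exists (idm (X : C)); rewrite ccomp1m.
- exists (@ccomp C _ _ _ f (stable (prod_fst X Z)) +
          @ccomp C _ _ _ s (stable (prod_snd X Z))); split.
    rewrite ccompDl !ccompDr -!ccompA !(ccompA (stable (prod_fst X Z) : @hom C _ _)).
    rewrite !(ccompA (stable (prod_snd X Z) : @hom C _ _)) p1i1 p2i2 p1i2 p2i1.
    by rewrite !ccomp0l !ccomp0r !ccomp1m addr0 add0r.
  rewrite ccompDl !ccompDr -!ccompA !(ccompA r) !(ccompA g) rf gs gf rs.
  by rewrite !ccomp0l !ccomp0r !ccomp1m addr0 add0r.
- by exists (idm (Z : C)); rewrite ccomp1m.
- exists (mhom_id X), (mhom_id _), (mhom_id _); split=> //.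
- by rewrite ccompm1 ccompDl -!ccompA rf gf ccomp0r ccompm1 addr0.
- rewrite ccomp1m ccompDr !ccompA p2i1 p2i2.
  by rewrite !ccomp0l ccomp1m add0r.
- by rewrite ccomp0r ccomp0l.
Qed.

Lemma semisimple_triangulated : triangulated_in D0.
Proof.
move=> X Y Z sX sY sZ f g hk hc.
have [gf _] := hk; have fm := kernel_in_mono hk; have ge := cokernel_in_epi hc.
have [h hh] := semisimple_regular (repr f : mhom X Y) sX sY.
pose r : @hom C Y X := stable (h : mhom Y X).
have frf : f \oc r \oc f = f.
  rewrite -(stable_repr f) (stable_comp _ (h : mhom Y X)) stable_comp; congr stable.
  by apply: linear_ext => x; exact: hh.
have rf : r \oc f = idm (X : C).
  by apply: (fm _ sX); rewrite ccompA frf ccompm1.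
have [_ hc'] := hc; have [|s [es _]] := hc' _ sY (idm (Y : C) - f \oc r).
  by rewrite ccompBl ccomp1m frf subrr.
exists 0; apply: (@split_triangle _ _ _ _ _ r s) => //.
  apply: (ge _ sZ); rewrite -ccompA es ccompBr ccompm1 ccompA gf ccomp0l.
  by rewrite subr0 ccomp1m.
by rewrite es addrC subrK.
Qed.

Lemma semisimple_distinguished_over_simples : distinguished_over_simples D0.
Proof.
split; [exact: semisimple_abelian|exact: semisimple_triangulated|].
by move=> S; exact: simple_semisimple.
Qed.

End SemisimpleSubcategory.

(** * Simple objects *)

Lemma schur (R : nzRingType) (S T : fgmodule R) (f : mhom S T) :
  simple_module S -> simple_module T -> (exists x, f x <> 0) ->
  exists g : mhom T S, mhom_comp g f = mhom_id S /\ mhom_comp f g = mhom_id T.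
Proof.
move=> [_ sS] [_ sT] [x0 fx0].
have fi : injective f.
  apply: linear_injective => x /kernel_predP hx.
  have [h|h] := sS _ (kernel_pred_closed f); first exact: h.
  by case: fx0; apply/kernel_predP.
have fs y : exists x, f x = y.
  have [h|h] := sT _ (image_pred_closed f); last exact/image_predP.
  by case: fx0; apply: h; apply/image_predP; exists x0.
have [g hg] := factor_inj (q := idfun : {linear T -> T}) fi fs.
exists g; split; apply: linear_ext => x; last exact: hg.
by apply: fi; exact: hg.
Qed.

Lemma modcat_simpleE (k : fieldType) (A : falgType k) (S : fgmodule A) :
  simple_object (S : modcat A) <-> simple_module S.
Proof.
split=> [[nS sS]|sS].
  split.
    apply: contrapT => h; apply/nS/zero_objectP; apply: linear_ext => x /=.
    by apply: contrapT => /eqP hx; apply: h; exists x.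
  move=> N hN; pose i : mhom (fgsubmodule hN) S := submod_incl hN.
  have im : @is_mono (modcat A) _ _ i.
    move=> T u v e; apply: linear_ext => t; apply: (@submod_incl_inj _ _ _ hN).
    exact: (congr1 (fun f : mhom T S => f t) e).
  have [/zero_objectP h|[g [_ ig]]] := sS _ i im; [left|right] => x.
    move=> /(submod_inclK hN)[y <-].
    have -> : y = 0.
      exact: (congr1 (fun f : mhom (fgsubmodule hN) (fgsubmodule hN) => f y) h).
    exact: linear0.
  have <- : i (g x) = x by exact: (congr1 (fun f : mhom S S => f x) ig).
  exact: submod_inclP.
split.
  move=> /zero_objectP h; have [[x /eqP hx] _] := sS; apply: hx.
  exact: (congr1 (fun f : mhom S S => f x) h).
move=> Y m mm.
(* Elements of the kernel are maps from the free module of rank one. *)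
have mi : injective m.
  apply: linear_injective => x hx.
  pose F : fgmodule A := FGModule (free_fg A 1).
  have e : @ccomp (modcat A) F Y S m (free_map (fun _ => x)) =
           @ccomp (modcat A) F Y S m (0 : mhom F Y).
    apply: linear_ext => u /=; rewrite linear_sum linear0 big1 // => i _.
    by rewrite linearZ_LR hx scaler0.
  have := congr1 (fun f : mhom F Y => f (const_mx 1)) (mm F _ _ e).
  by rewrite /= big_ord1 mxE scale1r.
have [_ sS'] := sS; have [h|h] := sS' _ (image_pred_closed m).
  left; apply/zero_objectP; apply: linear_ext => y; apply: mi.
  by rewrite !linear0; apply: h; apply/image_predP; exists y.
right; have ms x : exists y, m y = x by apply/image_predP.
have [g hg] := factor_inj (q := idfun : {linear S -> S}) mi ms.
exists g; split; apply: linear_ext => x; last exact: hg.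
by apply: mi; exact: hg.
Qed.

Section CountTransfer.
Variables (C1 C2 : preadditive) (R : C1 -> C2 -> Prop).
Hypothesis R1 : forall X, simple_object X -> exists2 Y, simple_object Y & R X Y.
Hypothesis R2 : forall Y, simple_object Y -> exists2 X, simple_object X & R X Y.
Hypothesis Riso : forall X X' Y Y', simple_object X -> simple_object X' ->
  R X Y -> R X' Y' -> isomorphic X X' <-> isomorphic Y Y'.

Lemma simple_count_transfer n : simple_count C1 n -> simple_count C2 n.
Proof.
move=> [S [sS iS aS]].
have /choice[S' hS'] : forall i, exists Y, simple_object Y /\ R (S i) Y.
  by move=> i; have [Y sY rY] := R1 (sS i); exists Y.
exists S'; split=> [i|i j h|Y sY]; first by case: (hS' i).
  by apply: iS; apply/(Riso (sS i) (sS j) (proj2 (hS' i)) (proj2 (hS' j))).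
have [X sX rX] := R2 sY; have [i hi] := aS X sX; exists i.
exact/(Riso sX (sS i) rX (proj2 (hS' i))).
Qed.

End CountTransfer.

(** The relation [R] stands for a bijection of isomorphism classes of simple
    objects that need not come from a functor. *)
Lemma ell_transfer (C1 C2 : preadditive) (R : C1 -> C2 -> Prop) :
  (forall X, simple_object X -> exists2 Y, simple_object Y & R X Y) ->
  (forall Y, simple_object Y -> exists2 X, simple_object X & R X Y) ->
  (forall X X' Y Y', simple_object X -> simple_object X' ->
     simple_object Y -> simple_object Y' ->
     R X Y -> R X' Y' -> isomorphic X X' <-> isomorphic Y Y') ->
  ell C1 = ell C2.
Proof.
move=> R1 R2 Riso.
pose Q X Y := [/\ simple_object X, simple_object Y & R X Y].
have e n : simple_count C1 n <-> simple_count C2 n.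
  split.
    apply: (@simple_count_transfer _ _ Q) => [X sX|Y sY|X X' Y Y' _ _ [sX sY r] [sX' sY' r']].
    - by have [Y sY r] := R1 X sX; exists Y.
    - by have [X sX r] := R2 Y sY; exists X.
    - exact: Riso.
  apply: (@simple_count_transfer _ _ (fun Y X => Q X Y))
    => [Y sY|X sX|Y Y' X X' _ _ [sX sY r] [sX' sY' r']].
  - by have [X sX r] := R2 Y sY; exists X.
  - by have [Y sY r] := R1 X sX; exists Y.
  - by apply: iff_sym; exact: Riso.
rewrite /ell; congr xget; apply/seteqP; split=> o [n -> /e h]; by exists n.
Qed.

Section StableSimples.
Variables (k : fieldType) (A : falgType k).
Hypothesis hself : selfinjective A.
Hypothesis hnonproj : forall S : fgmodule A, simple_module S -> ~ projective_module S.
Let C := stmodcat A.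
Implicit Types S T : fgmodule A.

Lemma simple_stable_nonzero S : simple_module S -> idm (S : C) <> 0.
Proof.
move=> sS /(stable_eq0 (mhom_id S))[P [u [v [hP e]]]].
apply: (hnonproj sS) => M N g f sg.
have [h hh] := hP _ _ g (f \o v : {linear P -> N}) sg.
by exists (h \o u : {linear S -> M}) => x /=; rewrite hh /= -e.
Qed.

Lemma stable_schur S T (f : @hom C S T) : simple_module S -> simple_module T ->
  f <> 0 -> exists (f0 : mhom S T) (g : mhom T S), f = stable f0 /\
    mhom_comp g f0 = mhom_id S /\ mhom_comp f0 g = mhom_id T.
Proof.
move=> sS sT f0; have [|g hg] := schur (f := repr f : mhom S T) sS sT.
  apply: contrapT => h; apply: f0; rewrite -(stable_repr f).
  apply/stable_eq0; apply: factors_ext (factors0 S T) => x /=.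
  by apply/esym; apply: contrapT => hx; apply: h; exists x.
by exists (repr f), g; rewrite stable_repr.
Qed.

Lemma simple_isoE S T : simple_module S -> simple_module T ->
  @isomorphic (modcat A) S T <-> @isomorphic C S T.
Proof.
move=> sS sT; split=> [[f [g [gf fg]]]|[f [g [gf fg]]]].
  exists (stable (f : mhom S T)), (stable (g : mhom T S)).
  split; rewrite stable_comp.
    by congr stable.
  by congr stable.
have [|f0 [g0 [_ h]]] := @stable_schur _ _ f sS sT; last by exists f0, g0.
by move=> f0; apply: (simple_stable_nonzero sS); rewrite -gf f0 ccomp0r.
Qed.

Variable D : C -> Prop.
Hypothesis hD : contains_simples D.

(** A nonzero subobject of [S] receives a nonzero map from a simple module [T];
    the composite [T -> S] is nonzero, hence an isomorphism. *)
Lemma simple_module_simple_object S (DS : D S) : simple_module S ->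
  simple_object (exist D S DS : full_subcategory D).
Proof.
move=> sS; split.
  by move/zero_objectP; exact: simple_stable_nonzero.
move=> [Y dY] m mm.
have [Y0|nY] := pselect (idm (Y : C) = 0); [left; exact/zero_objectP|right].
have [T [t [sT t0]]] := nonzero_from_simple hself nY.
have mt : @ccomp C T Y S m t <> 0.
  move=> e; apply: t0; apply: (mm (exist D T (hD sT))).
  exact: etrans e (esym (@ccomp0r C T Y S m)).
have [f0 [g [ef [_ fg]]]] := stable_schur sT sS mt.
pose s : @hom C S Y := @ccomp C S T Y t (stable g).
apply: (@mono_retraction_iso (full_subcategory D) (exist D Y dY) (exist D S DS) m s mm).
have e : @ccomp C S T S (@ccomp C T Y S m t) (stable g) = idm (S : C).
  by rewrite ef stable_comp fg.
exact: etrans (ccompA (m : @hom C Y S) t (stable g : @hom C S T)) e.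
Qed.

(** A simple object receives a nonzero map from a simple module, which is a
    simple object too. *)
Lemma simple_object_simple_module (X : full_subcategory D) :
  is_abelian (full_subcategory D) -> simple_object X ->
  exists2 S : fgmodule A, simple_module S & @isomorphic C (proj1_sig X) S.
Proof.
move=> ab sX; have [nX _] := sX.
have nX' : idm (proj1_sig X : C) <> 0 by move=> h; apply/nX/zero_objectP.
have [T [t [sT t0]]] := nonzero_from_simple hself nX'.
exists T => //; apply: iso_sym; exists t.
have [g hg] := @simple_map_iso _ (exist D T (hD sT) : full_subcategory D) X t ab
   (simple_module_simple_object (hD sT) sT) sX t0.
by exists g.
Qed.

Lemma ell_simples : is_abelian (full_subcategory D) ->
  ell (modcat A) = ell (full_subcategory D).
Proof.
move=> ab; apply: (@ell_transfer _ _
  (fun (S : modcat A) (X : full_subcategory D) => @isomorphic C (proj1_sig X) S)).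
- move=> S /modcat_simpleE sS; exists (exist D S (hD sS)).
    exact: simple_module_simple_object.
  by exists (idm (S : C)), (idm (S : C)); rewrite ccomp1m.
- move=> X sX; have [S sS h] := simple_object_simple_module ab sX.
  by exists S => //; apply/modcat_simpleE.
move=> S S' X X' /modcat_simpleE sS /modcat_simpleE sS' _ _ r r'.
rewrite (simple_isoE sS sS'); split=> h.
  have [f [g e]] := iso_trans (iso_trans r h) (iso_sym r').
  by exists f, g.
have h' : @isomorphic C (proj1_sig X) (proj1_sig X').
  by have [f [g e]] := h; exists f, g.
exact: iso_trans (iso_trans (iso_sym r) h') r'.
Qed.

End StableSimples.

Theorem theorem1p2 (k : fieldType) (A : falgType k)
    (hself : selfinjective A)
    (hnonproj : forall S : fgmodule A, simple_module S -> ~ projective_module S) :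
  (forall D : stmodcat A -> Prop,
     distinguished_abelian D ->
     (forall S : fgmodule A, simple_module S -> D S) ->
     [/\ forall (S : fgmodule A) (DS : D S), simple_module S ->
            simple_object (exist D S DS : full_subcategory D),
         forall X : full_subcategory D, simple_object X ->
           exists S : fgmodule A,
             simple_module S /\ @isomorphic (stmodcat A) (proj1_sig X) S
       & ell (modcat A) = ell (full_subcategory D)])
  /\
  (exists D : stmodcat A -> Prop,
     maximal_distinguished_abelian D /\
     ell (full_subcategory D) = ell (modcat A)).
Proof.
split=> [D [ab _] hD|].
  split.
  - by move=> S DS sS; exact: simple_module_simple_object.
  - by move=> X sX; have [S sS h] :=
      simple_object_simple_module hself hnonproj hD ab sX; exists S.
  - exact: ell_simples.
have [D [[ab tr hD] maxD]] := 
  exists_maximal_over_simples hself (semisimple_distinguished_over_simples A).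
have dD : distinguished_abelian D by apply/distinguished_inE.
exists D; split; last by apply/esym/ell_simples => //; case: dD.
split=> // D' /distinguished_inE[ab' tr'] s; apply: maxD => //.
by split=> // S sS; apply/s/hD.
Qed.
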